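(* Let $T$ be a finite tree with at least $2$ vertices. (a) The number of invariant factors of the critical group of any arithmetical structure on $T$ is at most $\ell(T)-2-\iota(T)$, or equivalently at most $|E(T)|-\nu_2(T)$. (b) For any integer $t$ with $0\le t\le \ell(T)-\iota(T)-2$, there is an arithmetical structure on $T$ whose critical group has $t$ invariant factors.
   Context: For a tree $T$ with adjacency matrix $A(T)$, an arithmetical structure on $T$ is a pair $(\mathbf{d},\mathbf{r})$ with $\mathbf{d}\in\mathbb{Z}_{\ge0}^{V(T)}$, $\mathbf{r}\in\mathbb{Z}_{>0}^{V(T)}$ whose entries have no nontrivial common factor, and $(\operatorname{diag}(\mathbf{d})-A(T))\mathbf{r}=\mathbf{0}$; its critical group is the torsion subgroup of $\mathbb{Z}^{V(T)}/\operatorname{im}(\operatorname{diag}(\mathbf{d})-A(T))$. The number of invariant factors of a finite abelian group is the number of nontrivial cyclic factors in its invariant factor decomposition. $\ell(T)$ is the number of leaves of $T$; $\nu_2(T)$ is the maximum size of a set of edges of $T$ in which every vertex is incident to at most $2$ edges. A starlike tree is a tree with exactly one vertex of degree at least $3$ (its central vertex). If a tree $T$ has at least two vertices of degree at least $3$, a starlike splitting of $T$ is a $4$-tuple $(S,T',v_s,v_t)$ where $S$ is a starlike tree, $T'$ is a tree, $v_s$ is a leaf of $S$ adjacent to the central vertex of $S$, $v_t\in V(T')$, and $T$ is obtained from $S$ and $T'$ by identifying $v_s$ with $v_t$; it is regular if $v_t$ has degree $1$ in $T'$ and irregular otherwise. Repeatedly applying starlike splittings (to the remaining tree $T'$) until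 the remaining tree is a starlike tree or a path graph yields a starlike decomposition of $T$. The splitting irregularity number $\iota(T)$ is the number of irregular splittings in such a sequence; it does not depend on the sequence chosen. *)

(* Defs.v *)
From HB Require Import structures.
From mathcomp Require Import all_boot all_order all_algebra.
From mathcomp Require Import generic_quotient ring_quotient.
From mathcomp Require Import boolp.
From mathcomp Require classical_sets.

Set Implicit Arguments.
Unset Strict Implicit.
Unset Printing Implicit Defensive.

Import Order.TTheory GRing.Theory Num.Theory.

(** * Finite simple graphs and trees *)

Record sgraph := SGraph {
  vertex :> finType;
  adj : rel vertex;
  adj_sym : symmetric adj;
  adj_irr : irreflexive adj
}.

Section Graph.
Variable T : sgraph.

Definition degree (v : T) : nat := #|[set w | adj v w]|.

Definition edges : {set {set T}} := [set [set u; v] | u in T, v in T & adj u v].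

Definition num_leaves : nat := #|[set v : T | degree v == 1]|.

Definition nu2 : nat :=
  \max_(M : {set {set T}} |
        (M \subset edges) && [forall v : T, #|[set F in M | v \in F]| <= 2]) #|M|.

Definition is_tree : Prop :=
  [/\ 0 < #|T|,
      forall u v : T, connect (@adj T) u v
    & forall c : seq T, ucycle (@adj T) c -> size c <= 2].

(* [f] numbers the vertices along the path. *)
Definition is_path_graph : Prop :=
  exists2 f : T -> 'I_#|T|, bijective f &
    forall u v : T, adj u v = (f u == (f v).+1 :> nat) || (f v == (f u).+1 :> nat).

Definition branch_vertices : {set T} := [set v : T | 3 <= degree v].

Definition is_starlike : Prop := is_tree /\ #|branch_vertices| = 1.

End Graph.

(** * Starlike decompositions *)

(* [T] is, up to isomorphism, the graph obtained from disjoint copies of [S]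
   and [T'] by identifying [vs] with [vt]. *)
Definition obtained_by_gluing (T S T' : sgraph) (vs : S) (vt : T') : Prop :=
  exists (f : S -> T) (g : T' -> T),
  [/\ injective f, injective g,
      forall z : T, (exists x, z = f x) \/ (exists y, z = g y),
      forall x y, f x = g y <-> x = vs /\ y = vt
    & forall z w : T, adj z w <->
        (exists x x', [/\ z = f x, w = f x' & adj x x']) \/
        (exists y y', [/\ z = g y, w = g y' & adj y y'])].

Record starlike_splitting (T S T' : sgraph) (vs : S) (vt : T') : Prop := {
  split_tree : is_tree T;
  split_branch : 2 <= #|branch_vertices T|;
  split_starlike : is_starlike S;
  split_rest : is_tree T';
  split_leaf : degree vs = 1;
  split_central : exists2 c : S, c \in branch_vertices S & adj vs c;
  split_glue : obtained_by_gluing T vs vt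
}.

(* [starlike_decomposition T k]: some starlike decomposition of [T] has
   exactly [k] irregular splittings. *)
Inductive starlike_decomposition : sgraph -> nat -> Prop :=
| Decomp_stop (T : sgraph) :
    is_starlike T \/ (is_tree T /\ is_path_graph T) ->
    starlike_decomposition T 0
| Decomp_split (T S T' : sgraph) (vs : S) (vt : T') (k : nat) :
    starlike_splitting T vs vt ->
    starlike_decomposition T' k ->
    starlike_decomposition T ((degree vt != 1) + k).

(* Computed from an arbitrarily chosen starlike decomposition; every tree with
   at least two vertices has one, and the number is independent of the choice. *)
Definition splitting_irregularity (T : sgraph) : nat :=
  classical_sets.xget 0%N (fun k => starlike_decomposition T k).

(** * Torsion and invariant factors of abelian groups *)

Local Open Scope ring_scope.

Section Cokernel.
Variables (n : nat) (M : 'M[int]_n).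

Definition im_mx : {pred 'cV[int]_n} := fun x => `[< exists y, x = M *m y >].

Lemma im_mx_zmod : zmod_closed im_mx.
Proof.
split=> [|x y /asboolP[a ->] /asboolP[b ->]]; apply/asboolP.
  by exists 0; rewrite mulmx0.
by exists (a - b); rewrite mulmxBr.
Qed.
HB.instance Definition _ := GRing.isZmodClosed.Build _ im_mx im_mx_zmod.

Definition coker_mx : zmodType := Quotient.quot im_mx.

End Cokernel.

Section Torsion.
Variable U : zmodType.

Definition is_torsion : {pred U} :=
  fun x => `[< exists2 n : nat, (0 < n)%N & x *+ n = 0 >].

Lemma is_torsion_zmod : zmod_closed is_torsion.
Proof.
split=> [|x y /asboolP[m m0 mx] /asboolP[n n0 ny]]; apply/asboolP.
  by exists 1%N.
exists (m * n)%N; first by rewrite muln_gt0 m0.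
by rewrite mulrnBl mulrnA mx mul0rn mulnC mulrnA ny mul0rn subrr.
Qed.
HB.instance Definition _ := GRing.isZmodClosed.Build _ is_torsion is_torsion_zmod.

Record torsion_sort := TorsionElt { torsion_val : U; _ : torsion_val \in is_torsion }.
HB.instance Definition _ := [isSub for torsion_val].
HB.instance Definition _ := [Choice of torsion_sort by <:].
HB.instance Definition _ := [SubChoice_isSubZmodule of torsion_sort by <:].

Definition torsion_subgroup : zmodType := torsion_sort.

End Torsion.

(* [G] is isomorphic to the product of the groups Z/s_i, with all s_i > 1 and
   s_0 | s_1 | s_2 | ...; the trivial group has the empty sequence. *)
Definition invariant_factors (G : zmodType) (s : seq nat) : Prop :=
  [/\ all (fun m => 1 < m)%N s, sorted dvdn s
    & exists f : G -> {dffun forall i : 'I_(size s), 'Z_(nth 0%N s i)},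
        bijective f /\ forall x y i, f (x + y) i = f x i + f y i].

(* Well defined for finite [G]: the invariant factors exist and are unique. *)
Definition num_invariant_factors (G : zmodType) : nat :=
  classical_sets.xget 0%N (fun t => exists2 s, invariant_factors G s & size s = t).

(** * Arithmetical structures *)

Section Arithmetical.
Variable T : sgraph.

Definition adj_mx : 'M[int]_#|T| :=
  \matrix_(i, j) (adj (enum_val i : T) (enum_val j))%:R.

Definition laplacian (d : 'rV[int]_#|T|) : 'M[int]_#|T| := diag_mx d - adj_mx.

Definition arithmetical_structure
    (d : 'rV[int]_#|T|) (r : 'cV[int]_#|T|) : Prop :=
  [/\ forall i, 0 <= d ord0 i,
      forall i, 0 < r i ord0,
      forall g : int, (forall i, (g %| r i ord0)%Z) -> `|g| = 1
    & laplacian d *m r = 0].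

(* The critical group of (d, r) depends on d only. *)
Definition critical_group (d : 'rV[int]_#|T|) : zmodType :=
  torsion_subgroup (coker_mx (laplacian d)).

End Arithmetical.

(* Main.v *)
(* Modulo a prime p the critical group sees only the nullity of the Laplacian:
   by the Smith normal form, and because the integral kernel has rank 1, the
   number t of invariant factors satisfies nullity mod p <= t + 1 for all p,
   with equality for some p when t > 0.

   Upper bound: deleting leaves one by one shows that, over any field and for
   any diagonal, the nullity is at most |V| - nu2.

   Realization: a tree is built from a single vertex by blow-ups at leaves,
   which keep all nullities, and by attaching at a vertex w a new vertex c
   carrying k >= 2 new leaves. Labelling the leaves 1, 2, ..., 2^(k-1) and c by
   2^k (all times the label of w) makes the diagonal even at the leaves, so
   that the nullity mod 2 grows by k - 1. Since |V| - nu2 drops by at most 1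
   when a leaf is deleted, intermediate values of t occur for subtrees and are
   transported to the tree by blow-ups.

   Irregularity: with b = sum of (deg v - 2)^+ = l - 2, a starlike splitting at
   a centre c changes b + nu2 - |E| by 1 if it is irregular and 0 otherwise. *)
Require Import Defs.
From mathcomp Require Import all_boot all_order all_algebra.
From mathcomp Require Import generic_quotient ring_quotient.
From mathcomp Require Import boolp zify ring.
From mathcomp Require classical_sets.

Set Implicit Arguments.
Unset Strict Implicit.
Unset Printing Implicit Defensive.

Import Order.TTheory GRing.Theory Num.Theory.
Local Open Scope ring_scope.
Local Open Scope quotient_scope.

(** The upper bound is proved for arbitrary diagonals over a field because eliminating a leaf
    subtracts an inverse from the diagonal entry of its neighbour, which leaves the class of
    integral Laplacians. In the realization one prime suffices from below: 2 forces the required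
    number of factors, while the upper bound at every prime forbids more. The powers of two meet two
    demands at once. With diagonal entry 1 at [c], the labels of [w] and of the new leaves must add
    up to the label of [c]; and every leaf label must divide the label of [c] with an even quotient.
    Relative to the label of [w] this is 1 + (1 + 2 + ... + 2^(k-1)) = 2^k. The entry at [w] then
    grows by 2^k, again an even number, so the equations modulo 2 on the rest of the tree are
    undisturbed. All notions are relative to a subset [U] of one fixed vertex type, with diagonals
    and vectors as functions on all vertices, so that deleting vertices never changes the type of
    the graph. *)

(** * Invariant factors of the torsion of a cokernel *)

(** Count the elements killed by a prime [p] dividing the first, hence every, entry of [s]: there
    are at least [p ^ size s] of them, and the second decomposition allows at most [p ^ size s']. *)
Lemma invariant_factors_size_le (G : zmodType) (s s' : seq nat) :
  invariant_factors G s -> invariant_factors G s' -> (size s <= size s')%N.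
Proof.
case: (posnP (size s)) => [->//|s_gt0].
move=> [/(all_nthP 0%N) s1 s_dvd [f [[g fK gK] fD]]].
move=> [/(all_nthP 0%N) s'1 _ [f' [bij_f' f'D]]].
set p := pdiv (nth 0%N s 0).
have p_pr : prime p by apply/pdiv_prime/s1.
have p_gt1 := prime_gt1 p_pr; have p_gt0 := prime_gt0 p_pr.
have p_dvd i : (i < size s)%N -> (p %| nth 0%N s i)%N.
  move=> lt_i; apply: dvdn_trans (pdiv_dvd _) _.
  by apply: (sorted_leq_nth dvdn_trans dvdnn 0%N s_dvd 0%N i) => //; apply: s_gt0.
have f0 i : f 0 i = 0 by apply: (addrI (f 0 i)); rewrite -fD !addr0.
have f'0 i : f' 0 i = 0 by apply: (addrI (f' 0 i)); rewrite -f'D !addr0.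
have fMn x n i : f (x *+ n) i = f x i *+ n.
  by elim: n => [|n IHn]; rewrite ?mulr0n ?f0 // !mulrS fD IHn.
have f'Mn x n i : f' (x *+ n) i = f' x i *+ n.
  by elim: n => [|n IHn]; rewrite ?mulr0n ?f'0 // !mulrS f'D IHn.
(* For [p] dividing [m], the multiples of [m / p] in [Z/m] are killed by [p]; [phi] lists the
   multipliers. *)
pose Phi (phi : {ffun 'I_(size s) -> 'I_p}) :
    {dffun forall i : 'I_(size s), 'Z_(nth 0%N s i)} :=
  finfun (fun i : 'I_(size s) =>
    ((phi i * (nth 0%N s i %/ p))%N)%:R : 'Z_(nth 0%N s i)).
have PhiE phi i : Phi phi i = ((phi i * (nth 0%N s i %/ p))%N)%:R.
  by rewrite ffunE.
(* A coordinate [y] in [Z/m] of an element killed by [p] satisfies [y * p = q * m] with [q < p], and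
   [q] determines [y]. The successor form of the codomain is what [inord] expects. *)
pose Psi (x : G) : {ffun 'I_(size s') -> 'I_p.-1.+1} :=
  [ffun i : 'I_(size s') => inord ((f' x i : nat) * p %/ nth 0%N s' i)].
have f'p x i : x *+ p = 0 ->
    exists2 q, (f' x i * p = q * nth 0%N s' i)%N & (q < p)%N.
  move=> xp0; have s'i1 := s'1 i (ltn_ord i).
  have f'p0 : (f' x i *+ p : 'Z_(nth 0%N s' i)) = 0 by rewrite -f'Mn xp0 f'0.
  have /dvdnP[q Eq] : (nth 0%N s' i %| f' x i * p)%N.
    by rewrite /dvdn -(val_Zp_nat s'i1) natrM natr_Zp mulr_natr f'p0.
  exists q => //; have : (f' x i < nth 0%N s' i)%N.
    by rewrite -[X in (_ < X)%N](Zp_cast s'i1) ltn_ord.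
  by rewrite -(ltn_pmul2r p_gt0) Eq mulnC ltn_pmul2l // ltnW.
have Psi_inj x y : x *+ p = 0 -> y *+ p = 0 -> Psi x = Psi y -> x = y.
  move=> xp yp /ffunP Exy; apply: (bij_inj bij_f'); apply/ffunP => i.
  have [q Eq ltq] := f'p _ i xp; have [q' Eq' ltq'] := f'p _ i yp.
  have := Exy i; rewrite !ffunE Eq Eq' !mulnK ?(ltnW (s'1 i (ltn_ord i))) //.
  move=> /(congr1 (@nat_of_ord _)); rewrite !inordK ?prednK // => Eqq.
  apply/val_inj/eqP; rewrite -(eqn_pmul2r p_gt0).
  by apply/eqP; rewrite /= Eq Eq' Eqq.
have Phi_p phi : g (Phi phi) *+ p = 0.
  apply: (can_inj fK); apply/ffunP => i; rewrite f0 fMn gK PhiE -mulrnA.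
  have s_i1 := s1 i (ltn_ord i).
  have -> : (phi i * (nth 0 s i %/ p) * p = phi i * nth 0 s i)%N.
    by rewrite -mulnA divnK // p_dvd.
  by rewrite mulnC mulrnA (pchar_Zp s_i1) mul0rn.
have: injective (Psi \o g \o Phi).
  move=> phi phi' /= /(Psi_inj _ _ (Phi_p _) (Phi_p _)) /(can_inj gK) E.
  apply/ffunP => i; have s_i1 := s1 i (ltn_ord i).
  have := congr1 (fun h : {dffun forall i : 'I_(size s), 'Z_(nth 0%N s i)} =>
     nat_of_ord (h i)) E.
  have lt_phi (psi : {ffun 'I_(size s) -> 'I_p}) :
      (psi i * (nth 0 s i %/ p) < nth 0 s i)%N.
    rewrite -[X in (_ < X)%N](divnK (p_dvd i (ltn_ord i))) mulnC ltn_pmul2l //.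
    by rewrite divn_gt0 // dvdn_leq ?p_dvd // ltnW.
  rewrite !PhiE !val_Zp_nat // !modn_small // => /eqP.
  have quo_gt0 : (0 < nth 0 s i %/ p)%N.
    by rewrite divn_gt0 // dvdn_leq ?p_dvd // ltnW.
  by rewrite (eqn_pmul2r quo_gt0) => /eqP/val_inj.
move/leq_card; rewrite !card_ffun !card_ord prednK //.
by rewrite leq_exp2l.
Qed.

Lemma num_invariant_factorsE (G : zmodType) (s : seq nat) :
  invariant_factors G s -> num_invariant_factors G = size s.
Proof.
move=> Gs; rewrite /num_invariant_factors.
have [|s' Gs' <-] := @classical_sets.xgetPex _ 0%N
  (fun t => exists2 s0, invariant_factors G s0 & size s0 = t).
  by exists (size s), s.
apply/eqP; rewrite eqn_leq.
by rewrite !(@invariant_factors_size_le G).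
Qed.

Lemma intr_Zp_eq0 (m : nat) (z : int) :
  (1 < m)%N -> (z%:~R == 0 :> 'Z_m) = (m %| `|z|)%N.
Proof.
move=> m1; have natZ k : (k%:R == 0 :> 'Z_m) = (m %| k)%N.
  by rewrite -val_eqE /= (val_Zp_nat m1).
by case: z => k; rewrite ?NegzE ?mulrNz ?oppr_eq0 ?abszN natZ.
Qed.

Lemma diag_mulE (K : pzRingType) (n : nat) (e : nat -> K) (u : 'cV[K]_n) i :
  ((\matrix_(i, j) (e i *+ (i == j :> nat))) *m u) i ord0 = e i * u i ord0.
Proof.
rewrite mxE (bigD1 i) //= mxE eqxx mulr1n big1 ?addr0 // => j ji.
by rewrite mxE eq_sym -val_eqE /= in ji *; rewrite (negPf ji) mul0r.
Qed.

(** In the coordinates [c] given by [L], the image of the matrix consists of the vectors whose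
    [i]-th coordinate is divisible by [e i]. Unit entries contribute nothing, the entry [e n = 0]
    contributes a free factor on which torsion elements vanish, and the entries in between give the
    cyclic factors. *)
Lemma torsion_coker_invariant_factors (n a : nat) (L R : 'M[int]_n.+1)
    (e : nat -> int) :
  L \in unitmx -> R \in unitmx -> (a <= n)%N ->
  (forall i, (i < a)%N -> `|e i|%N = 1%N) ->
  (forall i, (a <= i < n)%N -> (1 < `|e i|)%N) -> e n = 0 ->
  (forall i j, (i <= j)%N -> (e i %| e j)%Z) ->
  invariant_factors
    (torsion_subgroup
      (coker_mx (L *m (\matrix_(i, j) (e i *+ (i == j :> nat))) *m R)))
    (mkseq (fun i => `|e (a + i)%N|%N) (n - a)).
Proof.
move=> Lu Ru le_an e1 e_gt1 en e_dvd.
set D := (\matrix_(i, j) _ : 'M[int]_n.+1); set M := _ *m R; set s := mkseq _ _.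
pose c (y : 'cV[int]_n.+1) (i : 'I_n.+1) : int := (invmx L *m y) i ord0.
have cD x y i : c (x + y) i = c x i + c y i by rewrite /c mulmxDr mxE.
have cB x y i : c (x - y) i = c x i - c y i by rewrite /c mulmxBr !mxE.
have cM x m i : c (x *+ m) i = c x i *+ m.
  elim: m => [|m IHm]; first by rewrite !mulr0n /c mulmx0 mxE.
  by rewrite !mulrS cD IHm.
have imP y : reflect (forall i, (e i %| c y i)%Z) (y \in im_mx M).
  apply: (iffP idP) => [/asboolP[w ->] i|dv].
    by rewrite /c /M !mulmxA mulVmx // mul1mx -mulmxA diag_mulE dvdz_mulr.
  apply/asboolP; exists (invmx R *m (\col_i (c y i %/ e i)%Z)).
  rewrite /M -!mulmxA mulKVmx // -[LHS](mulKVmx Lu); congr (_ *m _).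
  by apply/colP => i; rewrite [RHS](diag_mulE e) [X in _ * X]mxE mulrC divzK.
have sz : size s = (n - a)%N by rewrite size_mkseq.
have ltn_s (i : 'I_(size s)) : (a + i < n)%N.
  by rewrite -ltn_subRL -sz ltn_ord.
have nth_s (i : 'I_(size s)) : nth 0%N s i = `|e (a + i)|%N.
  by rewrite nth_mkseq // -sz.
have s_gt1 (i : 'I_(size s)) : (1 < nth 0%N s i)%N.
  by rewrite nth_s e_gt1 // leq_addr ltn_s.
pose ix (i : 'I_(size s)) : 'I_n.+1 := inord (a + i).
have ixE i : ix i = (a + i)%N :> nat by rewrite inordK // ltnS ltnW.
pose pr (x : 'cV[int]_n.+1) : coker_mx M := \pi_(Quotient.quot (im_mx M)) x.
pose rp (q : coker_mx M) : 'cV[int]_n.+1 := repr (q : Quotient.quot (im_mx M)).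
have rpK q : pr (rp q) = q by apply: reprK.
have prD x y : pr (x + y) = pr x + pr y by apply: raddfD.
have prMn x m : pr (x *+ m) = pr x *+ m by apply: raddfMn.
have pr0 : pr 0 = 0 by apply: raddf0.
have eq_im x y : pr x = pr y -> x - y \in im_mx M.
  by move=> /eqP; rewrite Quotient.idealrBE.
have im_eq x y : x - y \in im_mx M -> pr x = pr y.
  by rewrite Quotient.idealrBE => /eqP.
pose f (x : torsion_subgroup (coker_mx M)) :
    {dffun forall i : 'I_(size s), 'Z_(nth 0%N s i)} :=
  finfun (fun i : 'I_(size s) => (c (rp (torsion_val x)) (ix i))%:~R : 'Z_(nth 0%N s i)).
have fE x i : f x i = (c (rp (torsion_val x)) (ix i))%:~R by rewrite ffunE.
have eq_Z (i : 'I_(size s)) (x y : 'cV[int]_n.+1) : x - y \in im_mx M ->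
    (c x (ix i))%:~R = (c y (ix i))%:~R :> 'Z_(nth 0%N s i).
  move=> /imP/(_ (ix i)); rewrite dvdzE ixE => dv; apply/eqP.
  by rewrite -subr_eq0 -intrB -cB intr_Zp_eq0 // nth_s.
have fD x y i : f (x + y) i = f x i + f y i.
  rewrite !fE -intrD -cD; apply: eq_Z; apply: eq_im.
  by rewrite prD !rpK.
have tors_last x : c (rp (torsion_val x)) ord_max = 0.
  case: x => q /= /asboolP[m m_gt0 qm0].
  have /imP/(_ ord_max) : rp q *+ m - 0 \in im_mx M.
    by apply: eq_im; rewrite prMn pr0 rpK.
  rewrite subr0 cM /= en dvd0z mulrn_eq0 => /orP[/eqP m0|/eqP//].
  by rewrite m0 in m_gt0.
have f_inj : injective f.
  move=> x y fxy; apply: val_inj => /=.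
  rewrite -[torsion_val x]rpK -[torsion_val y]rpK.
  apply: im_eq; apply/imP => i; rewrite cB.
  have [lt_ia|le_ai] := ltnP i a; first by rewrite dvdzE e1 // dvd1n.
  have := ltn_ord i; rewrite ltnS leq_eqVlt => /orP[/eqP i_n|lt_in].
    have -> : i = ord_max by apply: val_inj.
    by rewrite !tors_last subrr dvdz0.
  have lt_is : (i - a < size s)%N by rewrite sz ltn_sub2r // (leq_ltn_trans le_ai).
  have := congr1 (fun h : {dffun forall i : 'I_(size s), 'Z_(nth 0%N s i)} =>
    h (Ordinal lt_is)) fxy.
  rewrite !fE => /eqP; rewrite -subr_eq0 -intrB intr_Zp_eq0 // nth_s dvdzE /=.
  rewrite subnKC //.
  by have -> : ix (Ordinal lt_is) = i by apply: val_inj; rewrite [LHS]ixE /= subnKC.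
have f_surj g : exists x, f x = g.
  pose z : 'cV[int]_n.+1 := \col_j (if [pick i | ix i == j] is Some i
                                    then (g i : nat)%:Z else 0).
  have cz i : c (L *m z) i = z i ord0 by rewrite /c mulKmx.
  (* A common multiple of the entries strictly between the units and the zero; it kills the class of
     the lift, whose other coordinates are 0. *)
  pose m := (\prod_(a <= i < n) `|e i|)%N.
  have m_gt0 : (0 < m)%N.
    rewrite /m big_nat_cond prodn_cond_gt0 // => i /andP[/e_gt1/ltnW //].
  have q_tors : pr (L *m z) \in @is_torsion (coker_mx M).
    apply/asboolP; exists m => //; rewrite -prMn -pr0.
    apply: im_eq; rewrite subr0; apply/imP => i; rewrite cM cz mxE.
    case: pickP => [j /eqP ij|_]; last by rewrite mul0rn dvdz0.
    rewrite -mulr_natr dvdz_mull // natz dvdzE -ij ixE -[X in (_ %| X)%N]/m.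
    rewrite /m (@big_cat_nat _ _ _ (a + j)) ?leq_addr 1?ltnW //=.
    by apply: dvdn_mull; rewrite big_ltn // dvdn_mulr.
  exists (TorsionElt q_tors); apply/ffunP => i; rewrite fE /=.
  have -> : (c (rp (pr (L *m z))) (ix i))%:~R =
            (c (L *m z) (ix i))%:~R :> 'Z_(nth 0%N s i).
    by apply: eq_Z; apply: eq_im; rewrite rpK.
  rewrite cz mxE; case: pickP => [j /eqP ij|/(_ i)]; last by rewrite eqxx.
  have /val_inj -> : val j = val i.
    by apply/eqP; rewrite -(eqn_add2l a) -!ixE ij.
  exact: natr_Zp.
split.
- apply/(all_nthP 0%N) => i lt_i; exact: (s_gt1 (Ordinal lt_i)).
- apply/(sortedP 0%N) => i lt_i.
  rewrite (nth_s (Ordinal lt_i)) (nth_s (Ordinal (ltnW lt_i))) /=.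
  by have := e_dvd (a + i)%N (a + i.+1)%N; rewrite dvdzE; apply; rewrite leq_add2l.
exists f; split => //.
exists (fun g => projT1 (cid (f_surj g))) => [x|g].
  by apply: f_inj; case: cid.
by case: cid.
Qed.

(** The kernel is kept as a finite set: for prime [p] its cardinality is [p] to the nullity, and no
    ranks are needed. *)
Definition null_mod (p n : nat) (M : 'M[int]_n) : {set 'cV['F_p]_n} :=
  [set x | map_mx intr M *m x == 0].

(** Both [L] and [R] stay invertible modulo [p], so [R] carries the kernel onto the vectors
    supported on the indices where [p] divides [e i]. *)
Lemma card_null_mod (p n : nat) (L R : 'M[int]_n) (e : nat -> int) :
  prime p -> L \in unitmx -> R \in unitmx ->
  #|null_mod p (L *m (\matrix_(i, j) (e i *+ (i == j :> nat))) *m R)|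
  = (p ^ #|[set i : 'I_n | (p %| `|e i|)%N]|)%N.
Proof.
move=> p_pr Lu Ru; set J := [set i | _]; set D := \matrix_(i, j) _.
pose mp (m : nat) (A : 'M[int]_m) : 'M['F_p]_m := map_mx intr A.
have mpu (A : 'M[int]_n) : A \in unitmx -> mp n A \in unitmx.
  by rewrite !unitmxE /mp det_map_mx; apply: rmorph_unit.
have Lpu := mpu _ Lu; have Rpu := mpu _ Ru.
have mpD : mp n D = \matrix_(i, j) ((e i)%:~R *+ (i == j :> nat)).
  by apply/matrixP => i j; rewrite !mxE rmorphMn.
have Fp0 (z : int) : (z%:~R == 0 :> 'F_p) = (p %| `|z|)%N.
  have natF k : (k%:R == 0 :> 'F_p) = (p %| k)%N.
    by rewrite -(dvdn_pcharf (pchar_Fp p_pr)).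
  by case: z => k; rewrite ?NegzE ?mulrNz ?oppr_eq0 ?abszN natF.
pose h (f : {ffun 'I_n -> 'F_p}) := invmx (mp n R) *m \col_i f i.
have h_inj : injective h.
  move=> f g /(can_inj (mulKVmx Rpu)) /colP fg; apply/ffunP => i.
  by have := fg i; rewrite !mxE.
have -> : null_mod p (L *m D *m R) = h @: pffun_on 0 (mem J) predT.
  apply/setP => x; rewrite inE !map_mxM /= -!mulmxA -/(mp n L) -/(mp n D) -/(mp n R).
  apply/eqP/imsetP => [Mx0|[f /pffun_onP[/subsetP fJ _] ->]].
    exists [ffun i => (mp n R *m x) i ord0]; last first.
      rewrite /h -[LHS](mulKmx Rpu); congr (_ *m _).
      by apply/colP => i; rewrite !mxE ffunE mxE.
    apply/pffun_onP; split; last by [].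
    apply/subsetP => i; rewrite !inE ffunE => Rx_i.
    have : (mp n D *m (mp n R *m x)) i ord0 = 0.
      by rewrite -[mp n D *m _](mulKmx Lpu) Mx0 mulmx0 mxE.
    rewrite mpD (diag_mulE (fun i => (e i)%:~R)) => /eqP; rewrite mulf_eq0 (negPf Rx_i) orbF.
    by rewrite Fp0.
  rewrite /h mulKVmx // [mp n D *m _](_ : _ = 0) ?mulmx0 //.
  apply/colP => i.
  rewrite mpD [LHS](diag_mulE (fun i => (e i)%:~R)) !mxE.
  have [iJ|iNJ] := boolP (i \in J).
    by apply/eqP; rewrite mulf_eq0 Fp0; move: iJ; rewrite inE => ->.
  by rewrite (contraNeq (fJ i) iNJ) mulr0.
rewrite card_imset // card_pffun_on; congr (_ ^ _)%N.
by rewrite -[RHS](card_Fp p_pr); apply: eq_card.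
Qed.

(** A kernel of rank 1 leaves exactly one zero on the Smith diagonal, the last entry. If [a] entries
    are units then [t = n - a], and a prime can divide only the [t + 1] entries from index [a] on.
    It divides all of them if it divides the entry at [a]. *)
Lemma num_invariant_factors_coker (n : nat) (M : 'M[int]_n) (r : 'cV[int]_n) :
  r != 0 -> M *m r = 0 ->
  (forall x y : 'cV[int]_n, M *m x = 0 -> M *m y = 0 ->
    exists a b : int, ~~ ((a == 0) && (b == 0)) /\ a *: x = b *: y) ->
  let t := num_invariant_factors (torsion_subgroup (coker_mx M)) in
  (forall p, prime p -> (#|null_mod p M| <= p ^ t.+1)%N) /\
  (t = 0%N \/ exists2 p, prime p & #|null_mod p M| = (p ^ t.+1)%N).
Proof.
case: n M r => [|n] M r r_neq0 Mr0 Mrk1 /=.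
  by case/eqP: r_neq0; apply/colP => -[].
have [L Lu [R Ru [d d_sorted defM]]] := int_Smith_normal_form M.
pose e i := d`_i; move: defM.
have -> : (\matrix_(i < n.+1, j < n.+1) (d`_i *+ (i == j :> nat))) =
          \matrix_(i, j) (e i *+ (i == j :> nat)) by [].
set D := \matrix_(i, j) _ => defM.
have e_dvd i j : (i <= j)%N -> (e i %| e j)%Z.
  move=> le_ij; have [lt_j|le_j] := ltnP j (size d); last first.
    by rewrite [e j]nth_default ?dvdz0.
  apply: (sorted_leq_nth dvdz_trans dvdzz 0 d_sorted) => //.
  by rewrite inE (leq_ltn_trans le_ij).
have Rinv_null (i : 'I_n.+1) : e i = 0 -> M *m (invmx R *m delta_mx i (0 : 'I_1)) = 0.
  move=> ei0; rewrite defM -!mulmxA mulKVmx //.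
  rewrite [D *m _](_ : _ = 0) ?mulmx0 //; apply/colP => j.
  rewrite diag_mulE !mxE; case: eqP => [->|_]; last by rewrite mulr0.
  by rewrite ei0 mul0r.
have en0 : e n = 0.
  apply/eqP; apply: contraNT r_neq0 => en_neq0.
  have : D *m (R *m r) = 0.
    have LDRr0 : L *m (D *m (R *m r)) = 0 by rewrite !mulmxA -defM.
    by rewrite -[LHS](mulKmx Lu) LDRr0 mulmx0.
  move=> DRr0; rewrite -[r](mulKmx Ru) (_ : R *m r = 0) ?mulmx0 //.
  apply/colP => i; have := congr1 (fun A : 'cV[int]_n.+1 => A i ord0) DRr0.
  rewrite diag_mulE [RHS]mxE => /eqP; rewrite mulf_eq0.
  case/orP=> /eqP; last by move=> ->; rewrite mxE.
  move=> ei0.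
  by move: en_neq0 (e_dvd _ _ (ltn_ord i : (i <= n)%N)); rewrite ei0 dvd0z => /negPf->.
(* A second zero entry would yield two independent kernel vectors. *)
have e_neq0 i : (i < n)%N -> e i != 0.
  move=> lt_in; apply/eqP => ei0.
  pose i' : 'I_n.+1 := Ordinal (ltnW lt_in : (i < n.+1)%N).
  have [a [b [ab0]]] := Mrk1 _ _ (Rinv_null i' ei0) (Rinv_null ord_max en0).
  rewrite !scalemxAr => /(can_inj (mulKVmx Ru)) /colP ab.
  case/negP: ab0; have := ab i'; have := ab ord_max; rewrite !mxE /= !eqxx.
  rewrite -!val_eqE /= (ltn_eqF lt_in) (gtn_eqF lt_in) !mulr0 !mulr1 => <- ->.
  by rewrite eqxx.
(* The index [n] is always a candidate for the first nonunit, since [e n = 0]; reaching it means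
   that [t = 0]. *)
have ex_a : exists i, `|e i|%N != 1%N by exists n; rewrite en0.
case: (ex_minnP ex_a) => a ea_neq1 a_min.
have le_an : (a <= n)%N by apply: a_min; rewrite en0.
have e1 i : (i < a)%N -> `|e i|%N = 1%N.
  by move=> lt_ia; apply: contraTeq lt_ia => /a_min; rewrite leqNgt.
have e_neq1 i : (a <= i)%N -> `|e i|%N != 1%N.
  move=> /e_dvd; rewrite dvdzE => dv; apply: contraNneq ea_neq1 => ei1.
  by rewrite -dvdn1 -ei1.
have e_gt1 i : (a <= i < n)%N -> (1 < `|e i|)%N.
  move=> /andP[le_ai /e_neq0]; have := e_neq1 i le_ai.
  by rewrite -absz_eq0; case: `|e i|%N => [|[]].
have Gs := torsion_coker_invariant_factors Lu Ru le_an e1 e_gt1 en0 e_dvd.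
rewrite -/D -defM in Gs.
rewrite (num_invariant_factorsE Gs) size_mkseq.
have card_a : #|[set i : 'I_n.+1 | (a <= i)%N]| = (n - a).+1.
  transitivity (\sum_(a <= i < n.+1) 1)%N.
    by rewrite big_geq_mkord -sum1_card; apply: eq_bigl => i; rewrite inE.
  by rewrite sum_nat_const_nat muln1 subSn.
split=> [p p_pr|].
  rewrite defM card_null_mod // leq_exp2l ?prime_gt1 // -card_a.
  apply/subset_leq_card/subsetP => i; rewrite !inE => p_ei.
  rewrite leqNgt; apply: contraL p_ei => /e1 ->.
  by rewrite dvdn1 neq_ltn prime_gt1 ?orbT.
have [le_na|lt_an] := leqP n a; first by left; apply/eqP; rewrite subn_eq0.
have p_pr : prime (pdiv `|e a|) by rewrite pdiv_prime // e_gt1 ?leqnn.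
right; exists (pdiv `|e a|); rewrite // {1}defM card_null_mod //.
rewrite -card_a; congr (_ ^ #|pred_of_set _|)%N; apply/setP => i; rewrite !inE.
apply/idP/idP => [p_ei|/e_dvd]; last by rewrite dvdzE; apply/dvdn_trans/pdiv_dvd.
rewrite leqNgt; apply: contraL p_ei => /e1 ->.
by rewrite dvdn1 neq_ltn prime_gt1 ?orbT.
Qed.

(** * Null vectors of generalized Laplacians on vertex subsets *)

Section NullVectors.
Variable T : sgraph.
Implicit Types (U W Z B : {set T}).

(** Connectedness of the induced subgraph expressed through cuts, which avoids paths confined to a
    subset. *)
Definition connected_in U :=
  forall W, W \subset U -> W != set0 -> W != U ->
  exists x y, [/\ x \in W, y \in U :\: W & adj x y].

(** The kernel equations of [diag(D) - A] for the subgraph induced on [U]; values outside [U] are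
    irrelevant. *)
Definition null_on (K : pzSemiRingType) U (D X : T -> K) :=
  forall v, v \in U -> D v * X v = \sum_(w in U | adj v w) X w.

Lemma laplacian_nullP (K : pzRingType) (d : 'rV[K]_#|T|) (x : 'cV[K]_#|T|) :
  (diag_mx d - \matrix_(i, j) (adj (enum_val i : T) (enum_val j))%:R) *m x = 0 <->
  null_on setT (fun v => d ord0 (enum_rank v)) (fun v => x (enum_rank v) ord0).
Proof.
have mulE v : ((diag_mx d - \matrix_(i, j) (adj (enum_val i : T)
      (enum_val j))%:R) *m x) (enum_rank v) ord0 =
    d ord0 (enum_rank v) * x (enum_rank v) ord0 -
    \sum_(w in setT | adj v w) x (enum_rank w) ord0.
  rewrite mulmxBl mxE mul_diag_mx !mxE; congr (_ - _).
  rewrite (reindex (@enum_rank T)) /=; last exact/onW_bij/enum_rank_bij.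
  rewrite big_mkcond [RHS]big_mkcond; apply: eq_bigr => w _.
  by rewrite mxE !enum_rankK inE; case: adj; rewrite ?mul1r ?mul0r.
split=> [Lx0 v _|null_x].
  by apply/eqP; rewrite -subr_eq0 -mulE Lx0 mxE.
apply/colP => i; rewrite -(enum_valK i) [LHS]mulE.
by apply/eqP; rewrite mxE subr_eq0; apply/eqP/null_x.
Qed.

Definition vec_of (K : Type) (X : T -> K) : 'cV[K]_#|T| := \col_i X (enum_val i).

Lemma vec_ofE (K : Type) (X : T -> K) v : vec_of X (enum_rank v) ord0 = X v.
Proof. by rewrite mxE enum_rankK. Qed.

Lemma null_on_eq (K : pzSemiRingType) U (D D' X X' : T -> K) :
  {in U, D =1 D'} -> {in U, X =1 X'} -> null_on U D X -> null_on U D' X'.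
Proof.
move=> DD' XX' nullX v vU; rewrite -DD' // -XX' // nullX //.
by apply: eq_bigr => w /andP[wU _]; rewrite XX'.
Qed.

Lemma laplacian_map (K : pzRingType) (d : 'rV[int]_#|T|) :
  map_mx intr (laplacian d) =
  diag_mx (map_mx intr d) - \matrix_(i, j) (adj (enum_val i : T) (enum_val j))%:R
  :> 'M[K]_#|T|.
Proof.
apply/matrixP => i j; rewrite !mxE rmorphB rmorphMn /=; congr (_ - _).
by case: adj; rewrite ?rmorph1 ?rmorph0.
Qed.

(** Over a field this says that the nullity is at most [#|Z|], without mention of dimension. *)
Definition determined_by (K : pzSemiRingType) U (D : T -> K) Z :=
  forall X, null_on U D X -> {in Z, forall v, X v = 0} ->
  {in U, forall v, X v = 0}.

(** The dual condition: over a field the nullity is at least [#|B|], since the values on [B] can be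
    prescribed at will. *)
Definition free_on (K : pzSemiRingType) U (D : T -> K) B :=
  forall f : T -> K, exists2 X, null_on U D X & {in B, X =1 f}.

Definition mod_diag (p : nat) (D : T -> int) (v : T) : 'F_p := (D v)%:~R.

Definition diag_of (d : 'rV[int]_#|T|) (v : T) : int := d ord0 (enum_rank v).

Lemma null_modP (p : nat) (d : 'rV[int]_#|T|) (x : 'cV['F_p]_#|T|) :
  x \in null_mod p (laplacian d) <->
  null_on setT (mod_diag p (diag_of d)) (fun v => x (enum_rank v) ord0).
Proof.
rewrite inE laplacian_map; split=> [/eqP/laplacian_nullP|null_x].
  by apply: null_on_eq => v _ //; rewrite mxE.
apply/eqP/laplacian_nullP; apply: null_on_eq null_x => v _ //.
by rewrite mxE.
Qed.

Let restr (p : nat) Z (x : 'cV['F_p]_#|T|) : {ffun T -> 'F_p} :=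
  [ffun v => if v \in Z then x (enum_rank v) ord0 else 0].

Let card_restr (p : nat) Z : prime p ->
  #|pffun_on (0 : 'F_p) (mem Z) predT| = (p ^ #|Z|)%N.
Proof.
move=> p_pr; rewrite card_pffun_on; congr (_ ^ _)%N.
by rewrite -[RHS](card_Fp p_pr); apply: eq_card.
Qed.

Lemma card_null_mod_le (p : nat) (d : 'rV[int]_#|T|) Z :
  prime p -> determined_by setT (mod_diag p (diag_of d)) Z ->
  (#|null_mod p (laplacian d)| <= p ^ #|Z|)%N.
Proof.
move=> p_pr detZ; rewrite -(card_restr Z p_pr).
rewrite -(@card_in_imset _ _ (@restr p Z)).
  apply/subset_leq_card/subsetP => _ /imsetP[x _ ->].
  apply/pffun_onP; split; last by [].
  by apply/subsetP => v; rewrite inE ffunE; case: ifP; rewrite ?eqxx.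
move=> x y /null_modP nx /null_modP ny /ffunP xy.
apply/colP => i; apply/eqP; rewrite -subr_eq0; apply/eqP.
rewrite -(enum_valK i).
apply: (detZ (fun v => x (enum_rank v) ord0 - y (enum_rank v) ord0)) => //.
  by move=> v vT; rewrite mulrBr nx // ny // sumrB.
by move=> v vZ; have := xy v; rewrite !ffunE vZ => ->; rewrite subrr.
Qed.

Lemma card_null_mod_ge (p : nat) (d : 'rV[int]_#|T|) B :
  prime p -> free_on setT (mod_diag p (diag_of d)) B ->
  (p ^ #|B| <= #|null_mod p (laplacian d)|)%N.
Proof.
move=> p_pr freeB; rewrite -(card_restr B p_pr).
apply: leq_trans (leq_imset_card (@restr p B) _).
apply/subset_leq_card/subsetP => f /pffun_onP[/subsetP fB _].
have [X nullX Xf] := freeB f; apply/imsetP; exists (vec_of X).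
  by apply/null_modP; apply: null_on_eq nullX => v _ //; rewrite vec_ofE.
apply/ffunP => v; rewrite ffunE; case: ifP => [vB|/negP vB].
  by rewrite vec_ofE Xf.
by apply/eqP; apply: contraT => /fB.
Qed.

(* Maximum principle for the ratio [X / r]. *)
Lemma null_on_proportional (D r X : T -> int) :
  connected_in setT -> (forall v, 0 < r v) ->
  null_on setT D r -> null_on setT D X ->
  forall v w, r v * X w = r w * X v.
Proof.
move=> connT r_gt0 null_r null_X v0.
pose q v : rat := (X v)%:~R / (r v)%:~R.
have [m _ m_max] := @arg_maxP _ _ T v0 xpredT q isT.
have X_le w : r m * X w <= r w * X m.
  have : q w <= q m by exact: m_max.
  rewrite /q ler_pdivrMr ?ltr0z // mulrAC.
  by rewrite ler_pdivlMr ?ltr0z // -!intrM ler_int mulrC [X m * _]mulrC.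
pose W := [set w | r m * X w == r w * X m].
have WT : W = setT.
  apply/eqP; apply: contraT => W_neqT.
  have [||//|a [b]] := connT W; rewrite ?subsetT //.
    by apply/set0Pn; exists m; rewrite inE mulrC.
  rewrite !inE => -[/eqP aW /andP[bNW _] ab].
  have eqS : \sum_(w in setT | adj a w) (r w * X m - r m * X w) = 0.
    rewrite sumrB -mulr_suml -mulr_sumr -null_r ?inE // -null_X ?inE //.
    by rewrite mulrCA aW; ring.
  case/negP: bNW; move: eqS => /eqP.
  rewrite psumr_eq0 => [/allP/(_ b)|w _]; last by rewrite subr_ge0.
  by rewrite mem_index_enum inE ab /= subr_eq0 eq_sym => /(_ isT).
have mE w : r m * X w = r w * X m by apply/eqP; have := in_setT w; rewrite -WT inE.
move=> w; apply: (mulfI (lt0r_neq0 (r_gt0 m))).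
by rewrite mulrCA mE mulrCA -mE; ring.
Qed.

(** Connectedness enters here: every integral null vector is proportional to [r], which is the rank
    1 condition on the kernel. *)
Lemma critical_group_factors (d : 'rV[int]_#|T|) (r : 'cV[int]_#|T|) :
  (0 < #|T|)%N -> connected_in setT -> arithmetical_structure d r ->
  let t := num_invariant_factors (critical_group d) in
  (forall p, prime p -> (#|null_mod p (laplacian d)| <= p ^ t.+1)%N) /\
  (t = 0%N \/
   exists2 p, prime p & #|null_mod p (laplacian d)| = (p ^ t.+1)%N).
Proof.
move=> T_gt0 connT [_ r_gt0 _ Lr0].
have /card_gt0P[v0 _] := T_gt0.
apply: (num_invariant_factors_coker (r := r)) => // [|x y Lx Ly].
  apply/eqP => r0; have := r_gt0 (enum_rank v0).
  by rewrite r0 mxE ltxx.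
have prop (z : 'cV[int]_#|T|) : laplacian d *m z = 0 -> forall i,
    r (enum_rank v0) ord0 * z i ord0 = r i ord0 * z (enum_rank v0) ord0.
  move=> /laplacian_nullP null_z i; rewrite -(enum_valK i).
  have := null_on_proportional connT (fun v => r_gt0 (enum_rank v)) _ null_z.
  by apply; apply/laplacian_nullP.
have r0_neq0 := lt0r_neq0 (r_gt0 (enum_rank v0)).
(* The relation [y(v0) x = x(v0) y] could be trivial only when [x(v0) = 0]; in that case [x] itself
   is 0 by proportionality. *)
have [x0|x0] := eqVneq (x (enum_rank v0) ord0) 0.
  exists 1, 0; split=> //; apply/colP => i; rewrite !mxE mul0r mul1r.
  by apply/eqP; have /eqP := prop x Lx i; rewrite x0 mulr0 mulf_eq0 (negPf r0_neq0).
exists (y (enum_rank v0) ord0), (x (enum_rank v0) ord0).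
rewrite (negPf x0) andbF; split=> //; apply/colP => i; rewrite !mxE.
apply: (mulfI r0_neq0); rewrite mulrCA prop // [RHS]mulrCA [in RHS]prop //.
by ring.
Qed.

End NullVectors.

(** * Trees, forests and 2-matchings on vertex subsets *)

Section Forest.
Variable T : sgraph.
Implicit Types (U W Z B X : {set T}) (M : {set {set T}}).

Definition nb U v : {set T} := [set w in U | adj v w].

(** Acyclicity in hereditary form: leaves can be removed again and again inside any vertex
    subset. *)
Definition forest := forall W, W != set0 -> exists2 v, v \in W & (#|nb W v| <= 1)%N.

Lemma adjC (x y : T) : adj x y = adj y x.
Proof. exact: adj_sym. Qed.

Lemma adj_neq (x y : T) : adj x y -> x != y.
Proof. by apply: contraTneq => ->; rewrite adj_irr. Qed.

(** If all vertices of [W] had two neighbours in [W], paths in [W] could be prolonged beyond [#|T|]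
    vertices: the first vertex has a neighbour other than its successor, and if that neighbour
    already lies on the path, it closes a cycle of length at least 3. *)
Lemma acyclic_forest :
  (forall c : seq T, ucycle (@adj T) c -> size c <= 2)%N -> forest.
Proof.
move=> acyc W /set0Pn[x0 x0W]; apply/exists_inP; apply: contraT.
rewrite negb_exists => /forallP noleaf.
have nb2 v : v \in W -> (1 < #|nb W v|)%N.
  by move=> vW; have := noleaf v; rewrite vW /= -ltnNge.
have long n : exists x p,
    [/\ path (@adj T) x p, uniq (x :: p), all (mem W) (x :: p) & size p = n].
  elim: n => [|n [x [p [xp Up Wp sz]]]]; first by exists x0, [::]; rewrite /= x0W.
  have xW : x \in W by case/andP: Wp.
  have [y /andP[yN y_p]|no_y] := pickP [pred y in nb W x | y \notin p].
    move: yN; rewrite inE => /andP[yW xy].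
    exists y, (x :: p); split; rewrite /= ?sz //.
    - by rewrite adjC xy.
    - by rewrite inE negb_or eq_sym adj_neq //= y_p.
    - by rewrite yW.
  have [y yN y_hd] : exists2 y, y \in nb W x & y != head x p.
    have := nb2 x xW; rewrite (cardsD1 (head x p)) => nb_gt.
    have /card_gt0P[y] : (0 < #|nb W x :\ head x p|)%N.
      by move: nb_gt; case: (_ \in _) => //=; lia.
    by rewrite !inE => /andP[y1 y2]; exists y; rewrite ?inE.
  have y_p : y \in p by have := no_y y; rewrite inE yN /= => /negbFE.
  move: yN; rewrite inE => /andP[yW xy].
  case/path.splitP: {xp Up Wp sz no_y}y_p xp Up Wp sz y_hd no_y => p1 p2.
  case: p1 => [|z p1]; first by rewrite /= eqxx.
  move=> xp Up _ _ _ _.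
  have : ucycle (@adj T) (x :: rcons (z :: p1) y).
    rewrite /ucycle /cycle rcons_path last_rcons adjC xy andbT.
    move: xp Up; rewrite cat_path -cat_cons cat_uniq => /andP[-> _].
    by case/and3P.
  by move/acyc; rewrite /= size_rcons.
have [x [p [_ Up _ sz]]] := long #|T|.
by have := max_card (mem (x :: p)); rewrite (card_uniqP Up) /= sz ltnn.
Qed.

Lemma connect_connected_in :
  (forall u v : T, connect (@adj T) u v) -> connected_in [set: T].
Proof.
move=> conn W _ /set0Pn[x xW] WT.
have [y yW] : exists y, y \notin W.
  by apply/existsP; apply: contraR WT; rewrite negb_exists => /forallP allW;
     apply/eqP/setP => y; rewrite inE; apply/negPn/allW.
apply: contrapT => noedge.
have W_closed : closed (@adj T) (mem W).
  apply: intro_closed; first exact/sym_connect_sym/adj_sym.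
  move=> a b ab aW; apply: contrapT => /negP bW; apply: noedge.
  by exists a, b; rewrite !inE bW.
by move: xW yW; rewrite (closed_connect W_closed (conn x y)) => ->.
Qed.

(** The deleted part hangs on the rest at the single vertex [w]. A cut [W] of the rest becomes a cut
    of [U] by adding the deleted part when [w] is in [W], and is used as it is otherwise; the edge
    leaving the cut then stays in the rest. *)
Lemma connected_in_setD U X w :
  connected_in U ->
  (forall x y, x \in U :&: X -> y \in U :\: X -> adj x y -> y = w) ->
  connected_in (U :\: X).
Proof.
move=> connU Xw W WU W0 WUX.
have [wW|wNW] := boolP (w \in W).
  have [|||a [b [aW bW ab]]] := connU (W :|: (U :&: X)).
  - by rewrite subUset subsetIl (subset_trans WU) ?subsetDl.
  - by apply: contraNneq W0 => /eqP; rewrite setU_eq0 => /andP[].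
  - apply: contraNneq WUX => UE; rewrite eqEsubset WU; apply/subsetP => z.
    rewrite inE => /andP[zX zU]; have : z \in W :|: (U :&: X) by rewrite UE.
    by rewrite !inE (negPf zX) andbF orbF.
  move: bW; rewrite !inE negb_or -andbA => /and3P[bNW bNX bU].
  rewrite bU /= in bNX; exists a, b; rewrite !inE bNW bNX bU; split=> //.
  move: aW; rewrite inE => /orP[//|aX].
  by have := Xw a b aX; rewrite !inE bU bNX => /(_ isT ab) b_w; rewrite b_w wW in bNW.
have [|//||a [b [aW bW ab]]] := connU W; first exact: subset_trans WU (subsetDl _ _).
  by apply: contraNneq WUX => WE; rewrite eqEsubset WU WE subsetDl.
exists a, b; split=> //; move: bW; rewrite !inE => /andP[-> bU]; rewrite bU andbT /=.
apply/negP => bX; case/negP: wNW; rewrite -(Xw b a) ?inE ?bU //; last by rewrite adjC.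
by move/subsetP: WU => /(_ a aW); rewrite inE.
Qed.

Lemma connected_in_leaf U v : connected_in U -> (#|nb U v| <= 1)%N ->
  connected_in (U :\ v).
Proof.
move=> connU leaf_v; case: (set_0Vmem (nb U v)) => [nb0|[u uN]].
  apply: (connected_in_setD (w := v) connU) => x y.
  rewrite !inE => /andP[xU /eqP ->] /andP[_ yU] vy.
  by have := in_set0 y; rewrite -nb0 inE yU vy.
apply: (connected_in_setD (w := u) connU) => x y.
rewrite !inE => /andP[xU /eqP ->] /andP[_ yU] vy.
by apply: (card_le1_eqP leaf_v) => //; rewrite inE yU.
Qed.

Lemma connected_nb U v : connected_in U -> v \in U -> (1 < #|U|)%N ->
  (0 < #|nb U v|)%N.
Proof.
move=> connU vU U_gt1; have [|||a [b [/set1P-> bU ab]]] := connU [set v].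
- by rewrite sub1set.
- by apply/set0Pn; exists v; rewrite inE.
- by apply: contraTneq U_gt1 => <-; rewrite cards1.
by apply/card_gt0P; exists b; move: bU; rewrite !inE => /andP[_ ->].
Qed.

Lemma leaf_nb U v u : (#|nb U v| <= 1)%N -> u \in nb U v -> nb U v = [set u].
Proof.
move=> leaf_v uN; apply/setP => x; rewrite inE; apply/idP/eqP => [xN|-> //].
exact: (card_le1_eqP leaf_v).
Qed.

Lemma edgeP (e : {set T}) :
  reflect (exists u v, adj u v /\ e = [set u; v]) (e \in edges T).
Proof.
apply: (iffP imset2P) => [[u v _]|[u [v [uv ->]]]].
  by rewrite inE => /andP[_ uv] ->; exists u, v.
by exists u v => //; rewrite inE.
Qed.

Lemma edge_mem (e : {set T}) v :
  e \in edges T -> v \in e -> exists2 u, adj v u & e = [set v; u].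
Proof.
case/edgeP=> x [y [xy ->]]; rewrite !inE => /orP[]/eqP->.
  by exists y.
by exists x; rewrite 1?adjC // setUC.
Qed.

Definition edges_in U : {set {set T}} := [set e in edges T | e \subset U].

Definition at_vertex M v : {set {set T}} := [set F in M | v \in F].

Definition two_matching M := [forall v, #|at_vertex M v| <= 2]%N.

Definition nu2_in U : nat :=
  \max_(M : {set {set T}} | (M \subset edges_in U) && two_matching M) #|M|.

Lemma edges_inT : edges_in setT = edges T.
Proof. by apply/setP => e; rewrite inE subsetT andbT. Qed.

Lemma nu2_inT : nu2_in setT = nu2 T.
Proof. by apply: eq_bigl => M; rewrite edges_inT. Qed.

Lemma edges_inS U W : U \subset W -> edges_in U \subset edges_in W.
Proof.
by move=> UW; apply/subsetP => e; rewrite !inE => /andP[-> /subset_trans->].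
Qed.

Lemma at_vertexS M M' v : M \subset M' -> at_vertex M v \subset at_vertex M' v.
Proof. by move=> MM'; rewrite /at_vertex !setIdE setSI. Qed.

Lemma two_matchingS M M' : M \subset M' -> two_matching M' -> two_matching M.
Proof.
move=> MM' /forallP tm; apply/forallP => v.
by apply: leq_trans (tm v); apply/subset_leq_card/at_vertexS.
Qed.

Lemma nu2_in_max U M : M \subset edges_in U -> two_matching M ->
  (#|M| <= nu2_in U)%N.
Proof. by move=> MU tm; apply: leq_bigmax_cond; rewrite MU. Qed.

Lemma nu2_in_ex U :
  exists M, [/\ M \subset edges_in U, two_matching M & #|M| = nu2_in U].
Proof.
have : (0 < #|[pred M : {set {set T}} | (M \subset edges_in U) && two_matching M]|)%N.
  apply/card_gt0P; exists set0; rewrite inE sub0set; apply/forallP => v.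
  rewrite (_ : at_vertex _ _ = set0) ?cards0 //; apply/setP => F.
  by rewrite !inE.
move=> /(eq_bigmax_cond (fun M : {set {set T}} => #|M|)) [M /andP[MU tm] E].
by exists M; split; rewrite // -E.
Qed.

Lemma nu2_inS U W : U \subset W -> (nu2_in U <= nu2_in W)%N.
Proof.
move=> UW; have [M [MU tm <-]] := nu2_in_ex U.
by apply: nu2_in_max => //; apply: subset_trans (edges_inS UW).
Qed.

Lemma edges_in_mem U M (e : {set T}) v : M \subset edges_in U -> e \in M -> v \in e ->
  exists2 u, e = [set v; u] & (u \in nb U v) && (v \in U).
Proof.
move=> /subsetP MU /MU; rewrite inE => /andP[eT /subsetP eU] ve.
have [u vu eE] := edge_mem eT ve; exists u; rewrite // inE vu.
by rewrite !eU // eE !inE eqxx ?orbT.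
Qed.

Lemma card_at_vertex U M v : M \subset edges_in U ->
  (#|at_vertex M v| <= #|nb U v|)%N.
Proof.
move=> MU; apply: leq_trans (leq_imset_card (fun w => [set v; w]) _).
apply/subset_leq_card/subsetP => e; rewrite inE => /andP[eM ve].
by have [u -> /andP[uN _]] := edges_in_mem MU eM ve; apply: imset_f.
Qed.

Lemma two_matching_add M (e : {set T}) : two_matching M ->
  {in e, forall x, #|at_vertex M x| <= 1}%N -> two_matching (e |: M).
Proof.
move=> /forallP tm e1; apply/forallP => x.
have [xe|xNe] := boolP (x \in e).
  have : at_vertex (e |: M) x \subset e |: at_vertex M x.
    by apply/subsetP => F; rewrite !inE => /andP[/orP[->//|->] ->]; rewrite orbT.
  move/subset_leq_card/leq_trans; apply; rewrite cardsU1.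
  by apply: (@leq_add _ _ 1 1) (e1 x xe); case: (_ \notin _).
apply: leq_trans (tm x); apply/subset_leq_card/subsetP => F.
by rewrite !inE => /andP[/orP[/eqP->|->->//]]; rewrite (negPf xNe).
Qed.

Lemma sum_adjD1 (K : nmodType) U v x (X : T -> K) : v \in U ->
  \sum_(w in U | adj x w) X w =
  (if adj x v then X v else 0) + \sum_(w in U :\ v | adj x w) X w.
Proof.
move=> vU; case: ifP => xv.
  rewrite (bigD1 v) /= ?vU //; congr (_ + _); apply: eq_bigl => w.
  by rewrite !inE andbC andbA.
rewrite add0r; apply: eq_bigl => w; rewrite !inE.
by case: eqP => [->|] //=; rewrite xv andbF.
Qed.

Lemma edges_in_setD1 U M v : M \subset edges_in U ->
  {in M, forall e : {set T}, v \notin e} -> M \subset edges_in (U :\ v).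
Proof.
move=> MU Mv; apply/subsetP => e eM; have := subsetP MU e eM.
by rewrite !inE => /andP[-> eU]; rewrite subsetD1 eU Mv.
Qed.

Lemma sum_leaf (K : nmodType) U v u (X : T -> K) : nb U v = [set u] ->
  \sum_(w in U | adj v w) X w = X u.
Proof.
move=> nbE; transitivity (\sum_(w in [set u]) X w); last by rewrite big_set1.
by rewrite -nbE; apply: eq_bigl => w; rewrite inE.
Qed.

Lemma null_onD1 (K : pzSemiRingType) U v (D X : T -> K) : v \in U ->
  {in U :\ v, forall x, adj x v -> X v = 0} -> null_on U D X ->
  null_on (U :\ v) D X.
Proof.
move=> vU Xv nullX x xUv; rewrite nullX; last by move: xUv; rewrite inE => /andP[].
by rewrite (sum_adjD1 x X vU); case: ifP => [/Xv->|]; rewrite ?add0r.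
Qed.

(* Delete a leaf [v] with neighbour [u]. If the edge [uv] is in [M] and
   [D v != 0] then [v] is eliminated by a Schur complement at [u]; if [D v = 0]
   then [X u = 0], and the at most two edges of [M] at [u] pay for deleting
   both [u] and [v]. *)
Lemma determined_two_matching (K : fieldType) U (D : T -> K) M :
  forest -> M \subset edges_in U -> two_matching M ->
  exists Z, (#|Z| + #|M| <= #|U|)%N /\ determined_by U D Z.
Proof.
move=> forestT; have [n] := ubnP #|U|.
elim: n U D M => // n IHn U D M lt_Un MU tm.
have [U0|U_neq0] := eqVneq U set0.
  exists set0; split=> [|X _ _ v]; last by rewrite U0 inE.
  rewrite U0 cards0 add0n leqn0 cards_eq0; apply/eqP/setP => e; rewrite inE.
  apply/negP => /(subsetP MU); rewrite inE => /andP[/edgeP[x [y [_ ->]]] /subsetP].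
  by move=> /(_ x); rewrite U0 !inE eqxx => /(_ isT).
have [v vU leaf_v] := forestT U U_neq0.
have cardU : #|U| = #|U :\ v|.+1 by rewrite (cardsD1 v) vU.
have lt_Uv : (#|U :\ v| < n)%N by move: lt_Un; rewrite cardU.
(* If no edge of [M] meets [v], the vertex pays for itself: it joins [Z], and [M] survives in
   [U :\ v]. *)
have [e /andP[eM ve]|noe] := pickP [pred e in M | v \in e]; last first.
  have MUv : M \subset edges_in (U :\ v).
    by apply: edges_in_setD1 => // e eM; have := noe e; rewrite /= eM /= => ->.
  have [Z [leZ detZ]] := IHn _ D M lt_Uv MUv tm.
  exists (v |: Z); split=> [|X nullX X0].
    by rewrite cardsU1 cardU -addnA -add1n leq_add ?leq_b1.
  have Xv : X v = 0 by apply: X0; rewrite !inE eqxx.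
  move=> x xU; have [->//|x_v] := eqVneq x v.
  apply: (detZ X); rewrite ?inE ?x_v //; first exact: null_onD1.
  by move=> y yZ; apply: X0; rewrite inE yZ orbT.
have [u eE /andP[uN _]] := edges_in_mem MU eM ve.
have nbE := leaf_nb leaf_v uN.
have vNu x : x \in U -> x != u -> adj x v = false.
  move=> xU; apply: contraNF => xv.
  by rewrite -in_set1 -nbE inE xU adjC.
have Me F : F \in M -> v \in F -> F = e.
  move=> FM vF; have [u' -> /andP[]] := edges_in_mem MU FM vF.
  by rewrite nbE => /set1P->.
have [uU vu] : u \in U /\ adj v u by move: uN; rewrite inE => /andP[].
have nullv (X : T -> K) : null_on U D X -> D v * X v = X u.
  by move=> ->//; rewrite (sum_leaf _ nbE).
have [Dv0|Dv_neq0] := eqVneq (D v) 0.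
  pose M' := [set F in M | u \notin F].
  have M'M : M' \subset M by apply/subsetP => F; rewrite inE => /andP[].
  have cardM : (#|M| <= #|M'| + 2)%N.
    rewrite -(cardsID (at_vertex M u) M) addnC leq_add //.
      apply/subset_leq_card/subsetP => F; rewrite !inE negb_and => /andP[].
      by case: (F \in M).
    apply: leq_trans (forallP tm u); exact/subset_leq_card/subsetIr.
  have M'U : M' \subset edges_in (U :\ u :\ v).
    apply: edges_in_setD1 => [|F]; last first.
      by rewrite inE => /andP[/Me FE uF]; apply: contra uF => /FE->;
        rewrite eE !inE eqxx orbT.
    apply: edges_in_setD1 => [|F]; first exact: subset_trans M'M MU.
    by rewrite inE => /andP[].
  have v_u : v != u by exact: adj_neq.
  have vUu : v \in U :\ u by rewrite !inE v_u.
  have cardU2 : #|U| = #|U :\ u :\ v|.+2.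
    by rewrite (cardsD1 u) uU (cardsD1 v (U :\ u)) vUu.
  have lt_U' : (#|U :\ u :\ v| < n)%N by move: lt_Un; rewrite cardU2 => /ltnW.
  have [Z [leZ detZ]] := IHn _ D M' lt_U' M'U (two_matchingS M'M tm).
  exists Z; split=> [|X nullX X0].
    rewrite cardU2 -addn2; apply: leq_trans (leq_add (leqnn _) cardM) _.
    by rewrite addnA leq_add2r.
  have Xu : X u = 0 by rewrite -nullv // Dv0 mul0r.
  have X0' : {in U :\ u :\ v, forall x, X x = 0}.
    apply: detZ => //; apply: null_onD1 => // [x|]; last exact: null_onD1.
    by rewrite !inE => /and3P[_ x_u xU]; rewrite vNu.
  (* The value at [v] comes last, from the equation at [u], where all other terms already vanish. *)
  have Xv : X v = 0.
    have := nullX u uU; rewrite Xu mulr0 (sum_adjD1 u X vU) adjC vu.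
    rewrite big1 ?addr0 // => w /andP[]; rewrite !inE => /andP[w_v wU] uw.
    by apply: X0'; rewrite !inE w_v wU eq_sym adj_neq.
  move=> x xU; have [->//|x_v] := eqVneq x v; have [->//|x_u] := eqVneq x u.
  by apply: X0'; rewrite !inE x_v x_u.
pose D' x := if x == u then D u - (D v)^-1 else D x.
have MUv : M :\ e \subset edges_in (U :\ v).
  apply: edges_in_setD1 => [|F]; first exact: subset_trans (subsetDl _ _) MU.
  by rewrite !inE => /andP[F_e FM]; apply: contra F_e => /(Me _ FM)->.
have [Z [leZ detZ]] := IHn _ D' _ lt_Uv MUv (two_matchingS (subsetDl _ _) tm).
exists Z; split=> [|X nullX X0].
  by rewrite cardU (cardsD1 e M) eM addnCA add1n ltnS.
have Xv : X v = X u / D v by rewrite -nullv // mulrC mulKf.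
have X0' : {in U :\ v, forall x, X x = 0}.
  apply: detZ => // x; rewrite !inE => /andP[x_v xU]; rewrite /D'.
  have := nullX x xU; rewrite (sum_adjD1 x X vU); have [->|x_u] := eqVneq x u.
    rewrite adjC vu mulrBl => ->.
    by rewrite Xv [_^-1 * _]mulrC addrAC subrr add0r.
  by rewrite vNu // add0r.
move=> x xU; have [->|x_v] := eqVneq x v; last by apply: X0'; rewrite !inE x_v.
by rewrite Xv X0' ?mul0r // !inE uU eq_sym adj_neq.
Qed.

End Forest.

(** * Arithmetical structures with prescribed nullities *)

Section Structures.
Variable T : sgraph.
Implicit Types (U W Z B : {set T}) (M : {set {set T}}) (D r : T -> int).

(* The normalization [r v = 1] for some [v] replaces coprimality of [r]; it is
   what survives all the extensions below. *)
Definition structure_on U D r :=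
  [/\ {in U, forall v, 0 <= D v}, {in U, forall v, 0 < r v}, null_on U D r
    & exists2 v, v \in U & r v = 1].

Definition blowup_diag u v D x : int :=
  if x == v then 1 else if x == u then D u + 1 else D x.

(** Diagonal entry 1 at the leaf [v] forces [X v = X u], and the extra term [X v] in the equation at
    [u] is absorbed by raising the entry there by 1. Null vectors on both sides thus correspond to
    each other, over any ring. *)
Lemma nullD1_blowup (K : pzRingType) U u v (D X : T -> K) :
  v \in U -> nb U v = [set u] -> X v = X u ->
  null_on (U :\ v) D X <->
  null_on U (fun x => if x == v then 1 else if x == u then D u + 1 else D x) X.
Proof.
move=> vU nbE Xv.
have [uU vu] : u \in U /\ adj v u.
  by have := set11 u; rewrite -nbE inE => /andP[].
have vNu x : x \in U -> x != u -> adj x v = false.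
  by move=> xU; apply: contraNF => xv; rewrite -in_set1 -nbE inE xU adjC.
have u_v : u != v by rewrite eq_sym adj_neq.
split=> nullX x; last first.
  rewrite inE => /andP[/[1!inE] x_v xU]; have := nullX x xU.
  rewrite (negPf x_v) (sum_adjD1 x X vU); case: eqVneq => [->|x_u].
    by rewrite adjC vu Xv mulrDl mul1r [X u + _]addrC => /addIr.
  by rewrite vNu // add0r.
move=> xU; case: eqVneq => [->|x_v]; first by rewrite mul1r (sum_leaf _ nbE).
rewrite (sum_adjD1 x X vU) -nullX ?inE ?x_v //; case: eqVneq => [->|x_u].
  by rewrite adjC vu Xv mulrDl mul1r addrC.
by rewrite vNu // add0r.
Qed.

Lemma structure_on_blowup U u v D r :
  v \in U -> nb U v = [set u] -> structure_on (U :\ v) D r ->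
  structure_on U (blowup_diag u v D) (fun x => if x == v then r u else r x).
Proof.
move=> vU nbE [D_ge0 r_gt0 null_r [w wUv rw]].
have uN : u \in nb U v by rewrite nbE set11.
have uUv : u \in U :\ v.
  by move: uN; rewrite !inE => /andP[-> /adj_neq]; rewrite eq_sym => ->.
have u_v : u != v by move: uUv; rewrite !inE => /andP[].
split.
- move=> x xU; rewrite /blowup_diag; case: eqVneq => // x_v.
  by case: eqVneq => _; [rewrite addr_ge0 ?D_ge0|rewrite D_ge0 // !inE x_v].
- by move=> x xU; case: eqVneq => [_|x_v]; rewrite r_gt0 // !inE x_v.
- apply/(nullD1_blowup D vU nbE); first by rewrite eqxx (negPf u_v).
  apply: null_on_eq null_r => // x; rewrite !inE => /andP[x_v _].
  by rewrite (negPf x_v).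
by move: wUv; rewrite !inE => /andP[w_v wU]; exists w; rewrite // (negPf w_v).
Qed.

Lemma mod_blowup p u v D x : mod_diag p (blowup_diag u v D) x =
  if x == v then 1 else if x == u then mod_diag p D u + 1 else mod_diag p D x.
Proof.
rewrite /mod_diag /blowup_diag; case: eqVneq => _; first by rewrite rmorph1.
by case: eqVneq => _ //; rewrite rmorphD rmorph1.
Qed.

Lemma free_on_blowup p U u v D B :
  v \in U -> nb U v = [set u] -> B \subset U :\ v ->
  free_on (U :\ v) (mod_diag p D) B ->
  free_on U (mod_diag p (blowup_diag u v D)) B.
Proof.
move=> vU nbE BU freeB f; have [X nullX Xf] := freeB f.
have uN : u \in nb U v by rewrite nbE set11.
have u_v : u != v by move: uN; rewrite !inE => /andP[_ /adj_neq]; rewrite eq_sym.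
exists (fun x => if x == v then X u else X x) => [|b bB]; last first.
  by have := subsetP BU b bB; rewrite !inE => /andP[/negPf-> _]; apply: Xf.
have : null_on U (fun x => if x == v then 1 else
    if x == u then mod_diag p D u + 1 else mod_diag p D x)
    (fun x => if x == v then X u else X x).
  apply/(nullD1_blowup _ vU nbE); first by rewrite eqxx (negPf u_v).
  apply: null_on_eq nullX => // x; rewrite !inE => /andP[x_v _].
  by rewrite (negPf x_v).
by apply: null_on_eq => x _; rewrite // mod_blowup.
Qed.

Lemma determined_by_blowup p U u v D Z :
  v \in U -> nb U v = [set u] -> determined_by (U :\ v) (mod_diag p D) Z ->
  determined_by U (mod_diag p (blowup_diag u v D)) Z.
Proof.
move=> vU nbE detZ X nullX XZ.
have uN : u \in nb U v by rewrite nbE set11.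
have uUv : u \in U :\ v.
  by move: uN; rewrite !inE => /andP[-> /adj_neq]; rewrite eq_sym => ->.
have Xv : X v = X u.
  have := nullX v vU; rewrite mod_blowup eqxx mul1r => ->.
  exact: sum_leaf nbE.
have X0 : {in U :\ v, forall x, X x = 0}.
  apply: detZ => //; apply/(nullD1_blowup _ vU nbE Xv).
  by apply: null_on_eq nullX => x _; rewrite // mod_blowup.
move=> x xU; have [->|x_v] := eqVneq x v; first by rewrite Xv X0.
by rewrite X0 // !inE x_v.
Qed.

(* The labels are [1, 2, ..., 2 ^ (k - 1)], so that together with one more
   label [1] they sum to [2 ^ k], with all quotients even. *)
Lemma egyptian_labels (L : {set T}) :
  exists a q : T -> nat, (forall l, 0 < a l)%N /\
  [/\ {in L, forall l, a l * q l = 2 ^ #|L|}%N, {in L, forall l, 2 %| q l}%N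
    & (\sum_(l in L) a l).+1 = (2 ^ #|L|)%N].
Proof.
have [n] := ubnP #|L|; elim: n L => // n IHn L lt_L.
have [->|/set0Pn[l0 l0L]] := eqVneq L set0.
  exists (fun=> 1%N), (fun=> 0%N); split=> //.
  by split=> [l|l|]; rewrite ?inE // big_set0 cards0.
have cardL : #|L| = #|L :\ l0|.+1 by rewrite (cardsD1 l0) l0L.
have [|a [q [a_gt0 [aq q2 sum_a]]]] := IHn (L :\ l0).
  by move: lt_L; rewrite cardL.
(* The new leaf gets label 1 and the old labels are doubled, which keeps their quotients: if the old
   sum [s] has [s + 1 = 2^k], then [(2 s + 1) + 1 = 2^(k+1)]. *)
exists (fun l => if l == l0 then 1%N else (a l).*2).
exists (fun l => if l == l0 then (2 ^ #|L|)%N else q l).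
split=> [l|]; first by case: eqP; rewrite // double_gt0.
have LD l : l \in L -> l != l0 -> l \in L :\ l0 by rewrite !inE => -> ->.
split=> [l lL|l lL|].
- case: eqVneq => [_|/(LD l lL) lLD]; first by rewrite mul1n.
  by rewrite -mul2n -mulnA aq // cardL expnS.
- case: eqVneq => [_|/(LD l lL)/q2//]; by rewrite cardL expnS dvdn_mulr.
rewrite (bigD1 l0) //= eqxx cardL expnS -sum_a.
rewrite [X in (1 + X)%N](_ : _ = (\sum_(l in L :\ l0) a l).*2).
  by rewrite add1n mul2n doubleS.
rewrite -mul2n big_distrr /=; apply: eq_big => [l|l /andP[_ /negPf->]].
  by rewrite !inE andbC.
by rewrite mul2n.
Qed.

Section StarAttach.
Variables (U L : {set T}) (c w : T) (D0 r0 : T -> int).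
Let U0 := U :\: (c |: L).
Hypotheses (cU : c \in U) (wU0 : w \in U0) (nbc : nb U c = w |: L)
  (nbL : {in L, forall l, nb U l = [set c]}) (L_gt1 : (1 < #|L|)%N).

Let adjcL l : l \in L -> adj c l.
Proof.
move=> lL; have : l \in nb U c by rewrite nbc !inE lL orbT.
by rewrite inE => /andP[].
Qed.

Let cNL : c \notin L.
Proof. by apply/negP => /adjcL; rewrite adj_irr. Qed.

Let wU : w \in U. Proof. by move: wU0; rewrite inE => /andP[]. Qed.
Let wNL : w \notin L.
Proof. by move: wU0; rewrite !inE negb_or => /andP[/andP[]]. Qed.
Let w_c : w != c.
Proof. by move: wU0; rewrite !inE negb_or => /andP[/andP[]]. Qed.

Let U0E x : (x \in U0) = [&& x \in U, x != c & x \notin L].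
Proof. by rewrite !inE negb_or andbC. Qed.

Lemma sum_star (K : nmodType) (X : T -> K) x : x \in U ->
  \sum_(y in U | adj x y) X y =
  if x == c then X w + \sum_(l in L) X l else
  if x \in L then X c else
  (if x == w then X c else 0) + \sum_(y in U0 | adj x y) X y.
Proof.
move=> xU; case: eqVneq => [->|x_c].
  transitivity (\sum_(y in w |: L) X y); last by rewrite big_setU1.
  by rewrite -nbc; apply: eq_bigl => y; rewrite inE.
have [xL|xL] := boolP (x \in L); first by rewrite (sum_leaf _ (nbL xL)).
have xN y : y \in L -> adj x y = false.
  move=> yL; apply: contraNF x_c => xy.
  by rewrite -in_set1 -(nbL yL) inE xU adjC.
rewrite (sum_adjD1 x X cU); congr (_ + _).
  rewrite (_ : adj x c = (x == w)) //; apply/idP/eqP => [xc|->]; last first.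
    by have := setU11 w L; rewrite -nbc inE adjC => /andP[].
  have : x \in nb U c by rewrite inE xU adjC.
  by rewrite nbc !inE (negPf xL) orbF => /eqP.
apply: eq_bigl => y; rewrite U0E !inE.
by case: (boolP (y \in L)) => [/xN->|_]; rewrite ?andbF // andbT [(y != c) && _]andbC.
Qed.

Variables (a q : T -> nat).
Hypotheses (a_gt0 : forall l, (0 < a l)%N)
  (aq : {in L, forall l, a l * q l = 2 ^ #|L|}%N)
  (q2 : {in L, forall l, 2 %| q l}%N)
  (sum_a : (\sum_(l in L) a l).+1 = (2 ^ #|L|)%N).

(** At [c] the equation is the identity [sum_a] scaled by [r0 w], and at a leaf it is [aq] scaled
    likewise. At [w] the new neighbour contributes [2 ^ #|L|] times [r0 w], which the raised
    diagonal entry balances. *)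
Let D x : int := if x == c then 1 else if x \in L then (q x)%:Z else
  if x == w then D0 w + (2 ^ #|L|)%N%:Z else D0 x.
Let r x : int := if x == c then (2 ^ #|L|)%N%:Z * r0 w else
  if x \in L then (a x)%:Z * r0 w else r0 x.

Lemma structure_on_star : structure_on U0 D0 r0 -> structure_on U D r.
Proof.
case=> D_ge0 r_gt0 null_r [v vU0 rv].
have pow_gt0 : (0 < 2 ^ #|L|)%N by rewrite expn_gt0.
split.
- move=> x xU; rewrite /D; case: eqVneq => // x_c.
  have [//|xL] := boolP (x \in L).
  by case: eqVneq => [_|_]; rewrite ?addr_ge0 ?D_ge0 // U0E xU x_c xL.
- move=> x xU; rewrite /r; case: eqVneq => [_|x_c].
    by rewrite mulr_gt0 ?r_gt0 ?ltz_nat.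
  have [_|xL] := boolP (x \in L); first by rewrite mulr_gt0 ?r_gt0 ?ltz_nat.
  by rewrite r_gt0 // U0E xU x_c xL.
- move=> x xU; rewrite (sum_star r xU) /D; case: eqVneq => [->|x_c].
    rewrite mul1r {1 2}/r eqxx (negPf w_c) (negPf wNL).
    rewrite (eq_bigr (fun l => (a l)%:Z * r0 w)) => [|l lL]; last first.
      by rewrite /r lL ifN //; apply: contraNneq cNL => <-.
    rewrite -mulr_suml -sum_a intS mulrDl mul1r; congr (_ + _ * _).
    by rewrite -natz natr_sum; apply: eq_bigr => l _; rewrite natz.
  have [xL|xL] := boolP (x \in L).
    by rewrite /r eqxx (negPf x_c) xL mulrA -PoszM mulnC aq.
  have sum_r0 : \sum_(y in U0 | adj x y) r y = D0 x * r0 x.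
    rewrite null_r ?U0E ?xU ?x_c //; apply: eq_bigr => y /andP[].
    by rewrite U0E /r => /and3P[_ /negPf-> /negPf->].
  rewrite sum_r0 /r (negPf x_c) (negPf xL) eqxx; case: eqVneq => [->|_].
    by rewrite mulrDl addrC.
  by rewrite add0r.
move: vU0; rewrite U0E => /and3P[vU v_c vL].
by exists v; rewrite // /r (negPf v_c) (negPf vL).
Qed.

(* Modulo 2 the diagonal vanishes on the leaves, so a null vector vanishes at
   [c] and the single equation at [c] constrains the values at the leaves. *)
Lemma free_on_star B l0 : l0 \in L -> B \subset U0 ->
  free_on U0 (mod_diag 2 D0) B ->
  free_on U (mod_diag 2 D) (B :|: L :\ l0).
Proof.
move=> l0L BU freeB f; have [X0 null_X0 X0f] := freeB f.
have even0 (k : nat) : (2 %| k)%N -> (k%:Z)%:~R = 0 :> 'F_2.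
  by move=> k2; apply/eqP; rewrite -(dvdn_pcharf (pchar_Fp (isT : prime 2))).
(* The value at [l0] is spent on solving the equation at [c]; the remaining leaves are free. *)
pose X x : 'F_2 := if x == c then 0 else if x == l0 then
    - (X0 w + \sum_(l in L :\ l0) f l) else if x \in L then f x else X0 x.
have l0_c : l0 != c by apply: contraTneq l0L => ->.
have w_l0 : w != l0 by apply: contraNneq wNL => ->.
exists X => [x xU|b].
  rewrite (sum_star X xU) /mod_diag /D; case: eqVneq => [->|x_c].
    rewrite {1 2}/X eqxx (negPf w_c) (negPf w_l0) (negPf wNL) mulr0.
    rewrite (bigD1 l0) //= {1}/X eqxx (negPf l0_c).
    rewrite (_ : \sum_(l in L | l != l0) X l = \sum_(l in L :\ l0) f l).
      by rewrite opprD subrK subrr.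
    apply: eq_big => [l|l /andP[lL /negPf l_l0]]; first by rewrite !inE andbC.
    by rewrite /X l_l0 lL ifN //; apply: contraNneq cNL => <-.
  have [xL|xL] := boolP (x \in L).
    by rewrite even0 ?q2 // mul0r /X eqxx.
  have -> : X x = X0 x.
    rewrite /X (negPf x_c) (negPf xL) ifN //.
    by apply: contraNneq xL => ->.
  have -> : \sum_(y in U0 | adj x y) X y = mod_diag 2 D0 x * X0 x.
    rewrite null_X0 ?U0E ?xU ?x_c //; apply: eq_bigr => y /andP[].
    rewrite U0E /X => /and3P[_ /negPf-> yL] _; rewrite (negPf yL) ifN //.
    by apply: contraNneq yL => ->.
  rewrite {1}/X eqxx if_same add0r; case: eqVneq => [->|//].
  by rewrite rmorphD /= even0 ?addr0 // -(subnKC L_gt1) expnS dvdn_mulr.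
rewrite !inE => /orP[bB|/andP[b_l0 bL]]; rewrite /X.
  have := subsetP BU b bB; rewrite U0E => /and3P[_ /negPf-> bL].
  by rewrite (negPf bL) ifN ?X0f //; apply: contraNneq bL => ->.
rewrite bL (negPf b_l0) ifN //; by apply: contraTneq bL => ->.
Qed.

End StarAttach.
End Structures.

(** * Structures of maximal nullity modulo 2 *)

Section Extremal.
Variable T : sgraph.
Implicit Types (U W Z B : {set T}) (M : {set {set T}}) (D r : T -> int).

Lemma nbD1 U v u : nb (U :\ v) u = nb U u :\ v.
Proof. by apply/setP => x; rewrite !inE andbA. Qed.

Lemma at_vertex0 U M v : M \subset edges_in U -> v \notin U -> at_vertex M v = set0.
Proof.
move=> MU vU; apply/setP => F; rewrite !inE; apply/negP => /andP[FM vF].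
by have [u _ /andP[_]] := edges_in_mem MU FM vF; apply/negP.
Qed.

Lemma edge_in U u v : u \in U -> v \in U -> adj u v -> [set u; v] \in edges_in U.
Proof.
move=> uU vU uv; rewrite inE; apply/andP; split; last first.
  by apply/subsetP => x /set2P[]->.
by apply/edgeP; exists u, v.
Qed.

Lemma two_matching_extend U M u v :
  M \subset edges_in U -> two_matching M -> v \notin U -> adj u v ->
  (#|at_vertex M u| <= 1)%N ->
  two_matching ([set u; v] |: M) /\ #|[set u; v] |: M| = #|M|.+1.
Proof.
move=> MU tm vU uv u1; split.
  apply: two_matching_add => // x /set2P[]->//.
  by rewrite (at_vertex0 MU vU) cards0.
rewrite cardsU1; have -> // : [set u; v] \notin M.
apply/negP => eM; have : [set u; v] \in at_vertex M v by rewrite inE eM !inE eqxx orbT.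
by rewrite (at_vertex0 MU vU) inE.
Qed.

(** A 2-matching of [U :\ v] uses at most one edge at [u], so there is room for the edge [uv]. *)
Lemma nu2_in_leaf U u v : v \in U -> nb U v = [set u] ->
  (#|nb (U :\ v) u| <= 1)%N -> (nu2_in (U :\ v) < nu2_in U)%N.
Proof.
move=> vU nbE u1; have [M [MU tm <-]] := nu2_in_ex (U :\ v).
have /[!inE]/andP[uU vu] : u \in nb U v by rewrite nbE set11.
have [|||tm' <-] := two_matching_extend (u := u) (v := v) MU tm.
- by rewrite !inE eqxx.
- by rewrite adjC.
- exact: leq_trans (card_at_vertex u MU) u1.
apply: nu2_in_max tm'; rewrite subUset sub1set edge_in 1?adjC //=.
exact: subset_trans MU (edges_inS (subsetDl _ _)).
Qed.

(** Two edges from [c] into [L] extend any 2-matching that avoids [c] and [L]. *)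
Lemma nu2_in_star U (L : {set T}) c : c \in U -> (1 < #|L|)%N -> c \notin L ->
  {in L, forall l, l \in U /\ adj c l} ->
  ((nu2_in (U :\: (c |: L))).+2 <= nu2_in U)%N.
Proof.
move=> cU L_gt1 cNL LU; have [M [MU tm <-]] := nu2_in_ex (U :\: (c |: L)).
have /card_gt0P[l1 l1L] := ltnW L_gt1.
have /card_gt0P[l2] : (0 < #|L :\ l1|)%N.
  by move: L_gt1; rewrite (cardsD1 l1) l1L.
rewrite 2!inE => /andP[l2_l1 l2L].
have [l1U cl1] := LU l1 l1L; have [l2U cl2] := LU l2 l2L.
have out x : x \in c |: L -> x \notin U :\: (c |: L) by move=> xcL; rewrite inE xcL.
have atc : at_vertex M c = set0 by rewrite (at_vertex0 MU) ?out ?setU11.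
have [|||tm1 card1] := two_matching_extend (u := c) (v := l1) MU tm => //.
- by rewrite out // setU1r.
- by rewrite atc cards0.
have M1U : [set c; l1] |: M \subset edges_in (c |: (l1 |: U :\: (c |: L))).
  have l1_in : l1 \in c |: (l1 |: U :\: (c |: L)) by apply/setU1r/setU11.
  rewrite subUset sub1set edge_in ?setU11 //=.
  by apply: subset_trans MU (edges_inS _); rewrite setUA subsetUr.
have [|||tm2 card2] := two_matching_extend (u := c) (v := l2) M1U tm1.
- rewrite !inE l2L orbT (negPf l2_l1) !orbF.
  by apply: contraNneq cNL => <-.
- by [].
- rewrite (_ : at_vertex _ c = [set [set c; l1]]) ?cards1 //.
  apply/setP => F; rewrite !inE; have := in_set0 F.
  rewrite -atc inE; case: eqVneq => [-> _|_ -> //].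
  by rewrite !inE eqxx.
rewrite -card1 -card2; apply: nu2_in_max tm2.
rewrite subUset sub1set edge_in //= subUset sub1set edge_in //=.
exact: subset_trans MU (edges_inS (subsetDl _ _)).
Qed.

(* Take a vertex [c] of degree at most 1 in the forest left after deleting all
   leaves: all neighbours of [c] but at most one are leaves. *)
Lemma extremal_configuration U :
  forest T -> connected_in U -> (1 < #|U|)%N ->
  (exists v u, [/\ v \in U, nb U v = [set u] & (#|nb (U :\ v) u| <= 1)%N]) \/
  (exists c w L, [/\ c \in U, w \in U :\: (c |: L), nb U c = w |: L,
     {in L, forall l, nb U l = [set c]} & (1 < #|L|)%N]).
Proof.
move=> forestT connU U_gt1; have nb_gt0 v := connected_nb (v := v) connU ^~ U_gt1.
pose U' := [set v in U | #|nb U v| != 1%N].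
have leafE v c : v \in nb U c -> c \in U -> v \notin U' -> nb U v = [set c].
  rewrite !inE => /andP[vU cv] cU; rewrite vU /= negbK => /eqP nb1.
  by apply: leaf_nb; rewrite ?nb1 // inE cU adjC.
(* Without any nonleaf all degrees are 1, and any vertex serves as [v]. *)
have [U'0|/forestT[c cU' c_leaf]] := eqVneq U' set0.
  have /card_gt0P[v vU] := ltnW U_gt1.
  have nbU x : x \in U -> #|nb U x| = 1%N.
    by move=> xU; have := in_set0 x; rewrite -U'0 inE xU /= => /negbFE/eqP.
  have /eqP/cards1P[u nbE] := nbU v vU.
  left; exists v, u; split=> //; rewrite nbD1 -(nbU u).
    exact/subset_leq_card/subsetDl.
  by have := set11 u; rewrite -nbE inE => /andP[].
have /[!inE]/andP[cU nbc1] := cU'.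
have nbcU' : nb U' c = nb U c :&: U'.
  by apply/setP => x; rewrite !inE; case: (x \in U); rewrite ?andbF // andbC.
(* Here [w] is the only neighbour of [c] that may be a nonleaf; if all neighbours are leaves, any of
   them is chosen. *)
have [w wN noU'] : exists2 w, w \in nb U c & forall x, x \in nb U c -> x != w -> x \notin U'.
  have [nb0|/set0Pn[w wN]] := eqVneq (nb U' c) set0.
    have /card_gt0P[w wN] := nb_gt0 c cU; exists w => // x xN _.
    by apply/negP => xU'; have := in_set0 x; rewrite -nb0 nbcU' inE xN xU'.
  exists w; first by move: wN; rewrite nbcU' inE => /andP[].
  move=> x xN; apply: contra => xU'; apply/eqP.
  by apply: (card_le1_eqP c_leaf); rewrite // nbcU' inE xN.
pose L := nb U c :\ w.
have cardL : #|nb U c| = #|L|.+1 by rewrite (cardsD1 w) wN.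
have nbL : {in L, forall l, nb U l = [set c]}.
  by move=> l; rewrite inE => /andP[/[1!inE] l_w lN]; apply: leafE => //; apply: noU'.
have [L_gt1|L_le1] := ltnP 1 #|L|.
  right; exists c, w, L; split=> //; last by rewrite setD1K.
  rewrite !inE eqxx /= orbF; move: wN; rewrite inE => /andP[-> /adj_neq].
  by rewrite eq_sym andbT.
(* As [c] is not a leaf, [L] is nonempty; being of size at most 1, it leaves [c] with degree 2, and
   the leaf [l] can be deleted. *)
have /card_gt0P[l lL] : (0 < #|L|)%N.
  by rewrite lt0n; apply: contraNneq nbc1; rewrite cardL => ->.
left; exists l, c; split; rewrite ?nbL //.
  by move: lL; rewrite !inE => /and3P[].
have lN : l \in nb U c by move: lL; rewrite inE => /andP[].
by have := cardsD1 l (nb U c); rewrite nbD1 lN cardL add1n => -[<-].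
Qed.

(** Both extensions preserve [#|U| <= #|B| + nu2_in U]. The leaf step adds 1 to [#|U|] and at least
    1 to [nu2_in U]. The star step adds [#|L| + 1] to [#|U|], [#|L| - 1] to [#|B|] and at least 2 to
    [nu2_in U]. *)
Lemma maximal_structure U :
  forest T -> connected_in U -> U != set0 ->
  exists D r B, [/\ structure_on U D r, B \subset U,
    (#|U| <= #|B| + nu2_in U)%N & free_on U (mod_diag 2 D) B].
Proof.
move=> forestT; have [n] := ubnP #|U|; elim: n U => // n IHn U lt_U connU.
move=> /set0Pn[v0 v0U]; have [U_gt1|U_le1] := ltnP 1 #|U|; last first.
  have UE : U = [set v0].
    by apply/setP => x; rewrite inE; apply/idP/eqP => [xU|->//]; apply: (card_le1_eqP U_le1).
  have null0 (K : pzRingType) (X : T -> K) : null_on U (fun=> 0) X.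
    move=> x; rewrite UE => /set1P->; rewrite mul0r big1 // => y.
    by rewrite inE => /andP[/eqP->]; rewrite adj_irr.
  exists (fun=> 0), (fun=> 1), U; split=> //.
  - by split=> //; [apply: null0 | exists v0].
  - by rewrite leq_addr.
  by move=> f; exists f => //; apply: null_on_eq (null0 _ f) => x _ //; rewrite rmorph0.
have [[v [u [vU nbE u1]]]|[c [w [L [cU wU0 nbc nbL L_gt1]]]]] :=
  extremal_configuration forestT connU U_gt1.
  have cardU : #|U| = #|U :\ v|.+1 by rewrite (cardsD1 v) vU.
  have [|||D [r [B [str BU cardB freeB]]]] := IHn (U :\ v).
  - by move: lt_U; rewrite cardU.
  - by apply: connected_in_leaf => //; rewrite nbE cards1.
  - by rewrite -card_gt0 -ltnS -cardU.
  exists (blowup_diag u v D), (fun x => if x == v then r u else r x), B; split.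
  - exact: structure_on_blowup.
  - exact: subset_trans BU (subsetDl _ _).
  - rewrite cardU (leq_ltn_trans cardB) // ltn_add2l; exact: nu2_in_leaf nbE u1.
  - exact: free_on_blowup.
set U0 := U :\: (c |: L) in wU0.
have LU l : l \in L -> l \in U /\ adj c l.
  by move=> lL; have : l \in nb U c; [rewrite nbc setU1r | rewrite inE => /andP[]].
have cNL : c \notin L by apply/negP => /LU[_]; rewrite adj_irr.
have [a [q [a_gt0 [aq q2 sum_a]]]] := egyptian_labels L.
have cLU : c |: L \subset U.
  by rewrite subUset sub1set cU; apply/subsetP => l /LU[].
have cardU : #|U| = (#|U0| + #|L|.+1)%N.
  by rewrite -(cardsID (c |: L) U) addnC (setIidPr cLU) cardsU1 cNL.
have [|||D [r [B [str BU cardB freeB]]]] := IHn U0.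
- by apply: leq_trans (lt_U : (#|U| <= n)%N); rewrite cardU addnS ltnS leq_addr.
- apply: (connected_in_setD (w := w) connU) => x y.
  rewrite inE => /andP[_ /setU1P[->|xL]]; rewrite inE => /andP[yNcL yU] xy.
    have : y \in nb U c by rewrite inE yU.
    rewrite nbc => /setU1P[//|yL]; by rewrite setU1r in yNcL.
  have : y \in nb U x by rewrite inE yU.
  by rewrite nbL // => /set1P yc; rewrite yc setU11 in yNcL.
- by apply/set0Pn; exists w.
have /card_gt0P[l0 l0L] := ltnW L_gt1.
do 2 eexists; exists (B :|: L :\ l0); split.
- exact: (structure_on_star cU wU0 nbc nbL a_gt0 aq sum_a str).
- rewrite subUset (subset_trans BU (subsetDl _ _)) /=.
  by apply/subsetP => l; rewrite !inE => /andP[_ /LU[]].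
- have dis : [disjoint B & L :\ l0].
    rewrite disjoint_subset; apply/subsetP => x /(subsetP BU).
    by rewrite !inE negb_or => /andP[/andP[_ /negPf->] _]; rewrite andbF.
  have /eqP -> : #|B :|: L :\ l0| == (#|B| + #|L :\ l0|)%N.
    by rewrite (leq_card_setU _ _).2.
  have nu := nu2_in_star cU L_gt1 cNL LU.
  rewrite cardU (cardsD1 l0 L) l0L add1n -addnA [(#|L :\ l0| + _)%N]addnC addnA.
  rewrite -[X in (_ + X <= _)%N]addn2 addnA addnAC leq_add2r.
  apply: leq_trans (leq_add (leqnn _) nu).
  by rewrite addn2 !addnS !ltnS.
exact: free_on_star.

Qed.
End Extremal.

(** * Counting in trees, and the two bounds on the number of factors *)

Section Trees.
Variable T : sgraph.
Implicit Types (U W Z B : {set T}) (M : {set {set T}}) (D r : T -> int).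

Lemma leaf_induction (P : {set T} -> Prop) : forest T ->
  (forall v, P [set v]) ->
  (forall U v u, v \in U -> nb U v = [set u] -> P (U :\ v) -> P U) ->
  forall U, connected_in U -> U != set0 -> P U.
Proof.
move=> forestT P1 PS U; have [n] := ubnP #|U|; elim: n U => // n IHn U lt_U connU U0.
have [U_gt1|U_le1] := ltnP 1 #|U|; last first.
  have /cards1P[v ->] : #|U| == 1%N by rewrite eqn_leq U_le1 card_gt0.
  exact: P1.
have [v vU leaf_v] := forestT U U0.
have /card_gt0P[u uN] := connected_nb connU vU U_gt1.
have cardU : #|U| = #|U :\ v|.+1 by rewrite (cardsD1 v) vU.
apply: (PS U v u) (leaf_nb leaf_v uN) _ => //; apply: IHn.
- by move: lt_U; rewrite cardU.
- exact: connected_in_leaf.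
- by rewrite -card_gt0 -ltnS -cardU.
Qed.

(** Here [s] plays the role of [t + 1]. The lower bound modulo 2 and the upper bound modulo every
    [p] must be carried together, since both survive a blow-up. When [s + nu2_in U = #|U|] they come
    from the extremal structure and from a maximum 2-matching. *)
Lemma exact_structure U s :
  forest T -> connected_in U -> U != set0 -> (0 < s)%N ->
  (s + nu2_in U <= #|U|)%N ->
  exists D r B, [/\ structure_on U D r, B \subset U, (s <= #|B|)%N,
    free_on U (mod_diag 2 D) B
    & forall p, exists2 Z : {set T}, (#|Z| <= s)%N & determined_by U (mod_diag p D) Z].
Proof.
move=> forestT connU U0 s_gt0.
have max_case W : connected_in W -> W != set0 -> (s + nu2_in W = #|W|)%N ->
  exists D r B, [/\ structure_on W D r, B \subset W, (s <= #|B|)%N,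
    free_on W (mod_diag 2 D) B
    & forall p, exists2 Z : {set T}, (#|Z| <= s)%N & determined_by W (mod_diag p D) Z].
  move=> connW W0 cardW.
  have [D [r [B [str BW cardB freeB]]]] := maximal_structure forestT connW W0.
  exists D, r, B; split=> // [|p]; first by rewrite -(leq_add2r (nu2_in W)) cardW.
  have [M [MW tm cardM]] := nu2_in_ex W.
  have [Z [cardZ detZ]] := determined_two_matching (mod_diag p D) forestT MW tm.
  by exists Z; rewrite // -(leq_add2r #|M|) {2}cardM cardW.
have [n] := ubnP #|U|; elim: n U connU U0 => // n IHn U connU U0 lt_U.
rewrite leq_eqVlt => /orP[/eqP/max_case|lt_s]; first exact.
have U_gt1 : (1 < #|U|)%N.
  by apply: leq_ltn_trans lt_s; apply: leq_trans s_gt0 (leq_addr _ _).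
have [v vU leaf_v] := forestT U U0.
have /card_gt0P[u uN] := connected_nb connU vU U_gt1.
have nbE := leaf_nb leaf_v uN.
have cardU : #|U| = #|U :\ v|.+1 by rewrite (cardsD1 v) vU.
have [||||D [r [B [str BU cardB freeB detU]]]] := IHn (U :\ v).
- exact: connected_in_leaf.
- by rewrite -card_gt0 -ltnS -cardU.
- by move: lt_U; rewrite cardU.
(* Strict inequality makes up for the lost vertex, because deleting it cannot increase [nu2_in]. *)
- rewrite -ltnS -cardU; apply: leq_ltn_trans lt_s.
  by rewrite leq_add2l nu2_inS ?subsetDl.
exists (blowup_diag u v D), (fun x => if x == v then r u else r x), B; split=> //.
- exact: structure_on_blowup.
- exact: subset_trans BU (subsetDl _ _).
- exact: free_on_blowup.
by move=> p; have [Z cardZ detZ] := detU p; exists Z; last exact: determined_by_blowup.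
Qed.

Lemma sum_card_nb U : forest T -> connected_in U -> U != set0 ->
  (\sum_(v in U) #|nb U v| + 2 = #|U|.*2)%N.
Proof.
move=> forestT; move: U; apply: leaf_induction => // [v|U v u vU nbE IH].
  rewrite big_set1 cards1 (_ : nb _ _ = set0) ?cards0 //.
  by apply/setP => x; rewrite !inE; case: eqVneq => // ->; rewrite adj_irr.
have nbS x : #|nb U x| = (adj x v + #|nb (U :\ v) x|)%N.
  have sumE W : #|nb W x| = (\sum_(w in W | adj x w) 1)%N.
    by rewrite -sum1_card; apply: eq_bigl => w; rewrite inE.
  by rewrite !sumE (sum_adjD1 x (fun=> 1%N) vU); case: adj.
rewrite (big_setD1 v vU) /= nbE cards1 (cardsD1 v U) vU doubleD -IH addnA.
congr (_ + _)%N; under eq_bigr do rewrite nbS.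
rewrite big_split /= addnA; congr (_ + _)%N.
rewrite [X in (_ + X)%N](_ : _ = 1%N) //.
transitivity (\sum_(x in nb U v) 1)%N; last by rewrite nbE big_set1.
rewrite big_mkcond [RHS]big_mkcond; apply: eq_bigr => x _; rewrite !inE adjC.
case: eqVneq => [->|_] /=; first by rewrite adj_irr andbF.
by case: (x \in U) => //=; case: adj.
Qed.

Lemma card_edges_in U : forest T -> connected_in U -> U != set0 ->
  #|edges_in U|.+1 = #|U|.
Proof.
move=> forestT; move: U; apply: leaf_induction => // [v|U v u vU nbE IH].
  rewrite cards1 (_ : edges_in _ = set0) ?cards0 //; apply/setP => e; rewrite !inE.
  apply/negP => /andP[/edgeP[x [y [xy ->]]]]; rewrite subUset !sub1set !inE.
  by case/andP=> /eqP xv /eqP yv; move: xy; rewrite xv yv adj_irr.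
have /[!inE]/andP[uU vu] : u \in nb U v by rewrite nbE set11.
rewrite (cardsD1 v U) vU -IH; congr _.+1.
rewrite (cardsD1 [set v; u]) edge_in // add1n; congr (_.+1).
apply: eq_card => e; rewrite !inE; case: (boolP (e \in edges T)) => eT; rewrite ?andbF //=.
rewrite subsetD1; case: (boolP (e \subset U)) => eU; rewrite ?andbF //= andbT.
have [ve|vNe] := boolP (v \in e); last first.
  by apply: contraNneq vNe => ->; rewrite !inE eqxx.
apply/negbTE; rewrite negbK; have [x vx eE] := edge_mem eT ve.
have : x \in nb U v by rewrite inE vx andbT (subsetP eU) // eE !inE eqxx orbT.
by rewrite nbE => /set1P <-; rewrite eE.
Qed.

Hypothesis treeT : is_tree T.

Lemma tree_forest : forest T.
Proof. by case: treeT => _ _; apply: acyclic_forest. Qed.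

Lemma tree_connected : connected_in [set: T].
Proof. by case: treeT => _ conn _; apply: connect_connected_in. Qed.

Lemma tree_neq0 : [set: T] != set0.
Proof. by rewrite -card_gt0 cardsT; case: treeT. Qed.

Lemma card_tree_edges : #|edges T|.+1 = #|T|.
Proof.
by rewrite -edges_inT (card_edges_in tree_forest tree_connected tree_neq0) cardsT.
Qed.

Lemma degree_nb (v : T) : degree v = #|nb [set: T] v|.
Proof. by apply: eq_card => w; rewrite !inE. Qed.

Lemma sum_degree : (\sum_(v : T) degree v + 2 = #|T|.*2)%N.
Proof.
rewrite -cardsT -(sum_card_nb tree_forest tree_connected tree_neq0).
by congr (_ + _)%N; apply: eq_big => v; rewrite ?inE // degree_nb.
Qed.

Lemma degree_gt0 (v : T) : (1 < #|T|)%N -> (0 < degree v)%N.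
Proof.
by rewrite degree_nb -cardsT => /(connected_nb tree_connected (in_setT v)).
Qed.

(** Sum over all vertices of [deg v + [deg v = 1] = (deg v - 2) + 2], where the difference is
    truncated and [deg v > 0], combined with the degree sum [2 |T| - 2]. *)
Lemma num_leavesE : (1 < #|T|)%N ->
  num_leaves T = (\sum_(v : T) (degree v - 2) + 2)%N.
Proof.
move=> T_gt1; apply/eqP; rewrite -(eqn_add2l (\sum_(v : T) degree v)).
rewrite addnCA sum_degree addnC -muln2 -sum_nat_const -big_split /=.
rewrite /num_leaves -sum1_card big_mkcond /= -big_split /=; apply/eqP.
apply: eq_bigr => v _; rewrite inE; have := degree_gt0 v T_gt1.
by case: (degree v) => [|[|k]] //= _; rewrite add0n subnK.
Qed.

Lemma nu2_le_edges : (nu2 T <= #|edges T|)%N.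
Proof.
have [M [ME _ cardM]] := nu2_in_ex [set: T].
by rewrite -nu2_inT -cardM -edges_inT subset_leq_card.
Qed.

Lemma num_invariant_factors_le (d : 'rV[int]_#|T|) (r : 'cV[int]_#|T|) :
  arithmetical_structure d r ->
  (num_invariant_factors (critical_group d) + nu2 T <= #|edges T|)%N.
Proof.
move=> str; have T_gt0 : (0 < #|T|)%N by case: treeT.
have [_ [->|[p p_pr card_null]]] := critical_group_factors T_gt0 tree_connected str.
  by rewrite add0n nu2_le_edges.
have [M [ME tm cardM]] := nu2_in_ex [set: T].
have [Z [cardZ detZ]] :=
  determined_two_matching (mod_diag p (diag_of d)) tree_forest ME tm.
have := card_null_mod_le p_pr detZ; rewrite card_null leq_exp2l ?prime_gt1 // => le_Z.
rewrite -ltnS card_tree_edges -cardsT -addSn -nu2_inT -cardM.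
by apply: leq_trans cardZ; rewrite leq_add2r.
Qed.

(** The nullity modulo 2 gives at least [t] factors. If there are any, some prime [p] has nullity
    one more than their number, and the bound at that [p] gives at most [t]. *)
Lemma num_invariant_factors_attained t : (t + nu2 T <= #|edges T|)%N ->
  exists (d : 'rV[int]_#|T|) (r : 'cV[int]_#|T|),
    arithmetical_structure d r /\ num_invariant_factors (critical_group d) = t.
Proof.
rewrite -ltnS card_tree_edges -addSn -nu2_inT => le_t.
have {}le_t : (t.+1 + nu2_in [set: T] <= #|[set: T]|)%N by rewrite cardsT.
have T_gt0 : (0 < #|T|)%N by case: treeT.
have [D [r [B [[D_ge0 r_gt0 null_r [v _ rv]] _ cardB freeB detD]]]] :=
  exact_structure tree_forest tree_connected tree_neq0 (ltn0Sn t) le_t.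
pose d : 'rV[int]_#|T| := \row_i D (enum_val i).
have dE x : diag_of d x = D x by rewrite /diag_of mxE enum_rankK.
have mdE p x : mod_diag p (diag_of d) x = mod_diag p D x by rewrite /mod_diag dE.
have str : arithmetical_structure d (vec_of r).
  split=> [i|i|g g_dvd|].
  - by rewrite mxE D_ge0 ?inE.
  - by rewrite mxE r_gt0 ?inE.
  - have := g_dvd (enum_rank v); rewrite vec_ofE rv dvdz1 => /eqP g1.
    by rewrite -abszE g1.
  apply/laplacian_nullP; apply: null_on_eq null_r => x _; first by rewrite -dE.
  by rewrite vec_ofE.
exists d, (vec_of r); split=> //.
have [le_null ex_null] := critical_group_factors T_gt0 tree_connected str.
set k := num_invariant_factors _ in le_null ex_null *.
have le_tk : (t <= k)%N.
  have freeB' : free_on setT (mod_diag 2 (diag_of d)) B.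
    move=> f; have [X nullX Xf] := freeB f; exists X => //.
    by apply: null_on_eq nullX => x _ //; rewrite mdE.
  have := leq_trans (card_null_mod_ge (isT : prime 2) freeB') (le_null 2 isT).
  by rewrite leq_exp2l // => /(leq_trans cardB).
apply/eqP; rewrite eqn_leq le_tk andbT; case: ex_null => [->//|[p p_pr card_null]].
have [Z cardZ detZ] := detD p.
have detZ' : determined_by setT (mod_diag p (diag_of d)) Z.
  by move=> X nullX; apply: detZ; apply: null_on_eq nullX => x _ //; rewrite mdE.
have := card_null_mod_le p_pr detZ'; rewrite card_null leq_exp2l ?prime_gt1 //.
by move=> /leq_trans/(_ cardZ).
Qed.

End Trees.

(** * Starlike splittings *)

Section OneBranch.
Variable S : sgraph.
Implicit Types (N : {set {set S}}) (x c : S).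

Lemma card_at_edges x : #|at_vertex (edges S) x| = degree x.
Proof.
rewrite degree_nb -(card_in_imset (f := fun w => [set x; w])).
  apply: eq_card => e; apply/idP/imsetP => [|[w]].
    rewrite inE => /andP[eE xe]; have [w xw ->] := edge_mem eE xe.
    by exists w; rewrite // !inE.
  rewrite !inE /= => xw ->; apply/andP; split; last exact: set21.
  by apply/edgeP; exists x, w.
move=> w w'; rewrite !inE /= => xw xw' /setP/(_ w).
by rewrite !inE eqxx orbT eq_sym (negPf (adj_neq xw)) => /esym/eqP.
Qed.

Lemma card_at_le N x : N \subset edges S -> (#|at_vertex N x| <= degree x)%N.
Proof. by move=> NE; rewrite -card_at_edges; apply/subset_leq_card/at_vertexS. Qed.

(** At least [degree c - 2] of the edges at [c] are missing from [N]; the additive form avoids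
    truncated subtraction. *)
Lemma card_matching_at N c : N \subset edges S -> (#|at_vertex N c| <= 2)%N ->
  (#|N| + degree c <= #|edges S| + 2)%N.
Proof.
move=> NE N2; set A := at_vertex (edges S) c.
have NA : N :&: A = at_vertex N c.
  apply/setP => e; rewrite !inE; case eN: (e \in N) => //=.
  by rewrite (subsetP NE).
have EA : edges S :&: A = A.
  by apply/setIidPr/subsetP => e; rewrite inE => /andP[].
rewrite -(cardsID A N) -(cardsID A (edges S)) NA EA card_at_edges.
rewrite addnC -addnA leq_add2l addnC leq_add //.
exact/subset_leq_card/setSD.
Qed.

Variable c : S.
Hypothesis branch_c : branch_vertices S = [set c].

Lemma degree_not_branch x : x != c -> (degree x <= 2)%N.
Proof.
move=> xc; rewrite leqNgt; apply: contra xc => x3.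
by rewrite -in_set1 -branch_c inE.
Qed.

Lemma one_branch_sum : (\sum_(x : S) (degree x - 2))%N = (degree c - 2)%N.
Proof.
rewrite (bigD1 c) //= big1 ?addn0 // => x xc; apply/eqP.
by rewrite subn_eq0 degree_not_branch.
Qed.

(** A maximum 2-matching when [c] is the only branch vertex, for distinct neighbours [a] and [b] of
    [c]. The choice of [a] and [b] stays open so that the edge to a glued leaf can be left out. *)
Definition trimmed (a b : S) : {set {set S}} :=
  edges S :\: at_vertex (edges S) c :|: [set [set c; a]; [set c; b]].

Lemma trimmed_props a b : adj c a -> adj c b -> a != b ->
  [/\ trimmed a b \subset edges S, two_matching (trimmed a b)
    & (#|trimmed a b| + degree c = #|edges S| + 2)%N].
Proof.
move=> ca cb ab.
have caE : [set c; a] \in edges S by apply/edgeP; exists c, a.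
have cbE : [set c; b] \in edges S by apply/edgeP; exists c, b.
have sub : trimmed a b \subset edges S.
  rewrite subUset subsetDl; apply/subsetP => e /set2P[]->//.
have neq : [set c; a] != [set c; b].
  apply: contra ab => /eqP/setP/(_ a); rewrite !inE eqxx orbT.
  by rewrite eq_sym (negPf (adj_neq ca)) => /esym.
have card_t : (#|trimmed a b| + degree c = #|edges S| + 2)%N.
  have : [disjoint edges S :\: at_vertex (edges S) c
                 & [set [set c; a]; [set c; b]]].
    rewrite disjoint_sym disjoint_subset; apply/subsetP => e /set2P[]->;
      by rewrite !inE eqxx ?caE ?cbE.
  rewrite -(leq_card_setU _ _).2 /trimmed => /eqP ->; rewrite cards2 neq addnAC; congr (_ + _)%N.
  rewrite -card_at_edges addnC -(cardsID (at_vertex (edges S) c) (edges S)).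
  by rewrite (setIidPr _) //; apply/subsetP => e; rewrite inE => /andP[].
split=> //; apply/forallP => x; have [->|xc] := eqVneq x c.
  apply: leq_trans (_ : #|[set [set c; a]; [set c; b]]| <= 2)%N; last first.
    by rewrite cards2; case: (_ != _).
  apply/subset_leq_card/subsetP => e; rewrite !inE.
  by case: (e \in edges S); case: (c \in e); rewrite ?andbF ?andbT.
by apply: leq_trans (card_at_le x sub) (degree_not_branch xc).
Qed.

Lemma nu2_one_branch : (nu2 S + degree c = #|edges S| + 2)%N.
Proof.
have : c \in branch_vertices S by rewrite branch_c set11.
rewrite inE => c3; apply/eqP; rewrite eqn_leq; apply/andP; split.
  have [N [NE tm cardN]] := nu2_in_ex [set: S]; rewrite edges_inT in NE.
  by rewrite -nu2_inT -cardN; apply: card_matching_at => //; apply: (forallP tm).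
have /card_gt1P[a [b [/[1!inE] ca /[1!inE] cb ab]]] := ltnW c3.
have [tE tm <-] := trimmed_props ca cb ab.
by rewrite leq_add2r -nu2_inT nu2_in_max // edges_inT.
Qed.

End OneBranch.

Lemma nu2_degree_le2 (T : sgraph) :
  (forall v : T, degree v <= 2)%N -> nu2 T = #|edges T|.
Proof.
move=> deg2; apply/eqP; rewrite eqn_leq nu2_le_edges -nu2_inT.
apply: nu2_in_max; first by rewrite edges_inT.
by apply/forallP => v; rewrite card_at_edges.
Qed.

Lemma path_graph_degree (T : sgraph) (v : T) : is_path_graph T -> (degree v <= 2)%N.
Proof.
case=> f bij_f adjE; have f_inj := bij_inj bij_f.
rewrite /degree cardE -(size_map (fun w => val (f w))).
apply: (@uniq_leq_size _ _ [:: (f v).+1; (f v).-1]).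
  by rewrite map_inj_uniq ?enum_uniq // => x y /val_inj/f_inj.
move=> i /mapP[w]; rewrite mem_enum inE adjE => /orP[]/eqP E ->.
  by rewrite !inE E /= eqxx orbT.
by rewrite !inE /= E eqxx.
Qed.

(** * Effect of one splitting on degrees, edges and 2-matchings *)

Section Splitting.
Variables (T S T' : sgraph) (vs : S) (vt : T').
Hypothesis splitT : starlike_splitting T vs vt.
Variables (f : S -> T) (g : T' -> T).
Hypotheses (f_inj : injective f) (g_inj : injective g)
  (fg_cover : forall z : T, (exists x, z = f x) \/ (exists y, z = g y))
  (fg_meet : forall x y, f x = g y <-> x = vs /\ y = vt)
  (fg_adj : forall z w : T, adj z w <->
    (exists x x', [/\ z = f x, w = f x' & adj x x']) \/
    (exists y y', [/\ z = g y, w = g y' & adj y y'])).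

Let fvs : f vs = g vt. Proof. by apply/fg_meet. Qed.

Let adj_f x x' : adj x x' -> adj (f x) (f x').
Proof. by move=> xx'; apply/fg_adj; left; exists x, x'. Qed.

Let adj_g y y' : adj y y' -> adj (g y) (g y').
Proof. by move=> yy'; apply/fg_adj; right; exists y, y'. Qed.

Lemma degree_f x : x != vs -> degree (f x) = degree x.
Proof.
move=> x_vs; rewrite /degree -(card_imset _ f_inj); apply: eq_card => w.
rewrite inE; apply/idP/imsetP => [/fg_adj[]|[x' /[1!inE] xx' ->]]; last exact: adj_f.
  by case=> a [x' [/f_inj <- -> xx']]; exists x'; rewrite ?inE.
by case=> y [y' [/fg_meet[xv _]]]; rewrite xv eqxx in x_vs.
Qed.

Lemma degree_g y : y != vt -> degree (g y) = degree y.
Proof.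
move=> y_vt; rewrite /degree -(card_imset _ g_inj); apply: eq_card => w.
rewrite inE; apply/idP/imsetP => [/fg_adj[]|[y' /[1!inE] yy' ->]]; last exact: adj_g.
  by case=> x [x' [/esym/fg_meet[_ yv]]]; rewrite yv eqxx in y_vt.
by case=> a [y' [/g_inj <- -> yy']]; exists y'; rewrite ?inE.
Qed.

Lemma degree_glue : degree (g vt) = (degree vs + degree vt)%N.
Proof.
rewrite /degree -(card_imset [set w | adj vs w] f_inj).
rewrite -(card_imset [set w | adj vt w] g_inj).
have dis : [disjoint f @: [set w | adj vs w] & g @: [set w | adj vt w]].
  rewrite disjoint_subset; apply/subsetP => _ /imsetP[x /[1!inE] vx ->].
  rewrite inE; apply/imsetP => -[y _ /fg_meet[xv _]].
  by move: vx; rewrite xv adj_irr.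
move: dis; rewrite -(leq_card_setU _ _).2 => /eqP <-; apply: eq_card => w.
rewrite !inE; apply/idP/orP => [/fg_adj[]|[]/imsetP[x /[1!inE] vx ->]].
- case=> x [x' [vx -> xx']]; left; apply/imset_f; rewrite inE.
  by move: vx; rewrite -fvs => /f_inj->.
- case=> y [y' [/g_inj -> -> yy']]; right; apply/imset_f; by rewrite inE.
- by rewrite -fvs; apply: adj_f.
- exact: adj_g.
Qed.

(** The shared vertex is counted on the side of [T']. *)
Lemma sum_glue (F : T -> nat) :
  (\sum_(z : T) F z = \sum_(x | x != vs) F (f x) + \sum_(y : T') F (g y))%N.
Proof.
rewrite (bigID (mem (f @: [set x | x != vs]))) /=; congr (_ + _)%N.
  rewrite big_imset /=; last exact: in2W.
  by apply: eq_bigl => x; rewrite inE.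
transitivity (\sum_(z in g @: [set: T']) F z)%N; last first.
  rewrite big_imset /=; last exact: in2W.
  by apply: eq_bigl => y; rewrite inE.
apply: eq_bigl => z; apply/idP/imsetP => [zNf|[y _ ->]].
  have [[x zx]|[y ->]] := fg_cover z; last by exists y.
  exists vt => //; rewrite -fvs zx; congr (f _); apply/eqP.
  by apply: contraNT zNf => x_vs; rewrite zx imset_f ?inE.
by apply/imsetP => -[x /[1!inE] x_vs /esym/fg_meet[xv _]]; rewrite xv eqxx in x_vs.
Qed.

Lemma edges_glue : edges T \subset
  [set f @: (e : {set S}) | e in edges S] :|: [set g @: (e : {set T'}) | e in edges T'].
Proof.
apply/subsetP => e /edgeP[z [w [/fg_adj[] zw ->]]]; rewrite inE.
  case: zw => x [x' [-> -> xx']]; apply/orP; left.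
  rewrite -!imset_set1 -imsetU; apply: imset_f; by apply/edgeP; exists x, x'.
case: zw => x [x' [-> -> xx']]; apply/orP; right.
rewrite -!imset_set1 -imsetU; apply: imset_f; by apply/edgeP; exists x, x'.
Qed.

Lemma edge_f (e : {set S}) : e \in edges S -> f @: e \in edges T.
Proof.
case/edgeP=> x [x' [xx' ->]]; rewrite imsetU !imset_set1; apply/edgeP.
by exists (f x), (f x'); split=> //; apply: adj_f.
Qed.

Lemma edge_g (e : {set T'}) : e \in edges T' -> g @: e \in edges T.
Proof.
case/edgeP=> x [x' [xx' ->]]; rewrite imsetU !imset_set1; apply/edgeP.
by exists (g x), (g x'); split=> //; apply: adj_g.
Qed.

Let vs1 : degree vs = 1%N. Proof. exact: split_leaf splitT. Qed.

(** A branch vertex of [T] other than the centre lies in [T']: either it is not the glued vertex, or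
    it is, and then its degree [1 + degree vt] forces a neighbour in [T']. This keeps [degree vt]
    positive and lets the induction continue. *)
Lemma card_rest : (1 < #|T'|)%N.
Proof.
have [c branch_c] : exists c, branch_vertices S = [set c].
  by have [_ /eqP/cards1P] := split_starlike splitT.
have /card_gt1P[a [b [aB bB ab]]] := split_branch splitT.
have [z zB z_c] : exists2 z, z \in branch_vertices T & z != f c.
  by have [<-|] := eqVneq a (f c); [exists b; rewrite // eq_sym | exists a].
have glue_case : z = g vt -> (1 < #|T'|)%N.
  move: zB; rewrite inE => zB zE; move: zB; rewrite zE degree_glue vs1.
  move=> /ltnW; rewrite add1n ltnS => /card_gt0P[y /[1!inE] vy].
  by apply/card_gt1P; exists vt, y; split; rewrite ?adj_neq.
have [[x zx]|[y zy]] := fg_cover z.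
  have [x_vs|x_vs] := eqVneq x vs; first by apply: glue_case; rewrite zx x_vs.
  have : x \in branch_vertices S by move: zB; rewrite zx !inE degree_f.
  by rewrite branch_c => /set1P xc; rewrite zx xc eqxx in z_c.
have [y_vt|y_vt] := eqVneq y vt; first by apply: glue_case; rewrite zy y_vt.
by apply/card_gt1P; exists y, vt.
Qed.

(** The only discrepancy is at the glued vertex: for [d = degree vt > 0], passing from [d] to
    [d + 1] raises the truncated [d - 2] by 1 unless [d = 1]. This is where irregularity is
    measured. *)
Lemma sum_degree_glue :
  (\sum_(z : T) (degree z - 2) =
   \sum_(x : S) (degree x - 2) + \sum_(y : T') (degree y - 2) + (degree vt != 1))%N.
Proof.
have vt_gt0 := degree_gt0 (split_rest splitT) vt card_rest.
rewrite sum_glue -addnA; congr (_ + _)%N.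
  rewrite [RHS](bigD1 vs) //= vs1 add0n; apply: eq_bigr => x x_vs.
  by rewrite degree_f.
rewrite (bigD1 vt) //= [in RHS](bigD1 vt) //= degree_glue vs1 [RHS]addnAC; congr (_ + _)%N.
  by case: (degree vt) vt_gt0 => [|[|k]] // _; rewrite add1n addn1 !subSS !subn0.
by apply: eq_bigr => y y_vt; rewrite degree_g.
Qed.

Lemma card_edges_glue : #|edges T| = (#|edges S| + #|edges T'|)%N.
Proof.
have [treeS _] := split_starlike splitT.
have := card_tree_edges (split_tree splitT).
have := card_tree_edges treeS; have := card_tree_edges (split_rest splitT).
rewrite -[#|T|]sum1_card sum_glue -[#|S|]sum1_card (bigD1 vs) //= !sum1_card add1n.
by move=> <- [<-] /=; rewrite addnS => -[].
Qed.

(** From above, a 2-matching of [T] restricts to both parts, and [c] costs [degree c - 2] edges of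
    [S]. From below, the two edges kept at [c] can be chosen away from [vs]; since [vs] is a leaf,
    the part in [S] then misses the glued vertex and is compatible with any 2-matching of [T']. *)
Lemma nu2_glue (c : S) : branch_vertices S = [set c] ->
  (nu2 T + degree c = nu2 T' + #|edges S| + 2)%N.
Proof.
move=> branch_c.
pose F (e : {set S}) : {set T} := f @: e; pose G (e : {set T'}) : {set T} := g @: e.
have F_inj : injective F by apply: imset_inj.
have G_inj : injective G by apply: imset_inj.
apply/eqP; rewrite eqn_leq; apply/andP; split.
  have [M [ME /forallP tm cardM]] := nu2_in_ex [set: T]; rewrite edges_inT in ME.
  pose M1 := [set e in edges S | F e \in M]; pose M2 := [set e in edges T' | G e \in M].
  have M_sub : M \subset F @: M1 :|: G @: M2.
    apply/subsetP => e eM; have := subsetP edges_glue e (subsetP ME e eM).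
    rewrite inE => /orP[]/imsetP[e' e'E eE]; rewrite inE; apply/orP; [left|right];
      by rewrite eE; apply: imset_f; rewrite inE e'E /= /F /G -eE.
  have at1 x : (#|at_vertex M1 x| <= 2)%N.
    apply: leq_trans (tm (f x)); rewrite -(card_imset _ F_inj).
    apply/subset_leq_card/subsetP => _ /imsetP[e /[!inE]/andP[/andP[_ eM] xe] ->].
    by rewrite eM imset_f.
  have tm2 : two_matching M2.
    apply/forallP => y; apply: leq_trans (tm (g y)); rewrite -(card_imset _ G_inj).
    apply/subset_leq_card/subsetP => _ /imsetP[e /[!inE]/andP[/andP[_ eM] xe] ->].
    by rewrite eM imset_f.
  have M1E : M1 \subset edges S by apply/subsetP => e; rewrite inE => /andP[].
  have M2E : M2 \subset edges_in setT.
    by rewrite edges_inT; apply/subsetP => e; rewrite inE => /andP[].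
  have le1 := card_matching_at M1E (at1 c).
  have le2 := nu2_in_max M2E tm2; rewrite nu2_inT in le2.
  rewrite -nu2_inT -cardM -addnA.
  apply: leq_trans (leq_add le2 le1); rewrite addnA leq_add2r addnC.
  apply: leq_trans (subset_leq_card M_sub) _; apply: leq_trans (leq_card_setU _ _) _.
  by rewrite !card_imset.
have c_branch : c \in branch_vertices S by rewrite branch_c set11.
have vsc : adj vs c.
  by have [c' ] := split_central splitT; rewrite branch_c => /set1P->.
have vs_adj x : adj vs x -> x = c.
  have : (#|[set w | adj vs w]| <= 1)%N by move: vs1; rewrite /degree => ->.
  by move=> /card_le1_eqP vs_le1 vsx; apply: vs_le1; rewrite inE.
(* The centre has degree at least 3, hence two neighbours besides [vs]. *)
have /card_gt1P[a [b [aN bN ab]]] : (1 < #|[set w | adj c w] :\ vs|)%N.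
  move: c_branch; rewrite inE /degree (cardsD1 vs) inE adj_sym vsc.
  by rewrite add1n ltnS.
move: aN bN; rewrite !inE => /andP[a_vs ca] /andP[b_vs cb].
have [NE tmN cardN] := trimmed_props branch_c ca cb ab.
set N := trimmed c a b in NE tmN cardN.
have N_vs e : e \in N -> vs \notin e.
  move=> eN; apply/negP => vse; have [x vsx eE] := edge_mem (subsetP NE e eN) vse.
  move: eN; rewrite /N /trimmed inE => /orP[|/set2P[]eE'].
  - by case/setDP=> eT; rewrite inE eT /= eE (vs_adj x vsx) set22.
  - move: vse; rewrite eE' !inE (negPf (adj_neq vsc)) eq_sym.
    by rewrite (negPf a_vs).
  - move: vse; rewrite eE' !inE (negPf (adj_neq vsc)) eq_sym.
    by rewrite (negPf b_vs).
have [M' [M'E tm' cardM']] := nu2_in_ex [set: T']; rewrite edges_inT in M'E.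
have FG_dis : [disjoint F @: N & G @: M'].
  rewrite disjoint_subset; apply/subsetP => _ /imsetP[e eN ->].
  rewrite inE; apply/imsetP => -[e' _ eE].
  have /edgeP[x [x' [_ exx']]] := subsetP NE e eN.
  have xe : x \in e by rewrite exx' set21.
  have : f x \in G e' by rewrite -eE imset_f.
  case/imsetP=> y _ /fg_meet[xv _]; have := N_vs e eN.
  by rewrite -xv xe.
rewrite -addnA -cardN addnA leq_add2r -nu2_inT -cardM' addnC.
rewrite -(card_imset (mem N) F_inj) -(card_imset (mem M') G_inj).
have /eqP <- : #|F @: N :|: G @: M'| == (#|F @: N| + #|G @: M'|)%N.
  by rewrite (leq_card_setU _ _).2.
rewrite -nu2_inT; apply: nu2_in_max.
  rewrite edges_inT subUset; apply/andP; split; apply/subsetP => _ /imsetP[e eM ->].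
    exact/edge_f/(subsetP NE).
  exact/edge_g/(subsetP M'E).
have at_g y : (#|at_vertex (F @: N :|: G @: M') (g y)| <= 2)%N.
  apply: leq_trans (forallP tm' y); rewrite -(card_imset _ G_inj).
  apply/subset_leq_card/subsetP => e0; rewrite inE => /andP[/setUP[]/imsetP[e eM ->]].
    by case/imsetP=> x xe /esym/fg_meet[xv _]; have := N_vs e eM; rewrite -xv xe.
  by rewrite mem_imset // => ye; apply: imset_f; rewrite inE eM.
apply/forallP => z; have [[x zx]|[y ->//]] := fg_cover z.
have [x_vs|x_vs] := eqVneq x vs; first by rewrite zx x_vs fvs.
apply: leq_trans (forallP tmN x); rewrite -(card_imset _ F_inj) zx.
apply/subset_leq_card/subsetP => e0; rewrite inE => /andP[/setUP[]/imsetP[e eM ->]].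
  by rewrite mem_imset // => xe; apply: imset_f; rewrite inE eM.
by case/imsetP=> y ye /fg_meet[xv _]; rewrite xv eqxx in x_vs.
Qed.

End Splitting.

(** All terms except [k] depend on [T] alone, so this also shows that the number of irregular
    splittings is independent of the decomposition. *)
Lemma decomposition_count (T : sgraph) (k : nat) :
  starlike_decomposition T k -> (1 < #|T|)%N ->
  (\sum_(v : T) (degree v - 2) + nu2 T = #|edges T| + k)%N.
Proof.
elim=> {T k} [T|T S T' vs vt k splitT _ IH _].
  case=> [[treeT /eqP/cards1P[c branch_c]]|[treeT pathT]] T_gt1; rewrite addn0.
    rewrite (one_branch_sum branch_c); have := nu2_one_branch branch_c.
    have : c \in branch_vertices T by rewrite branch_c set11.
    rewrite inE => c3 E; apply/eqP; rewrite -(eqn_add2r 2) -E addnAC subnK ?(ltnW c3) //.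
    by rewrite addnC.
  rewrite big1 => [|v _]; last by apply/eqP; rewrite subn_eq0 path_graph_degree.
  by rewrite nu2_degree_le2 // => v; apply: path_graph_degree.
have [f [g [f_inj g_inj cov meet adjE]]] := split_glue splitT.
have [c branch_c] : exists c, branch_vertices S = [set c].
  by have [_ /eqP/cards1P] := split_starlike splitT.
have T'_gt1 := card_rest splitT f_inj g_inj cov meet adjE.
have {}IH := IH T'_gt1.
have nuE := nu2_glue splitT f_inj g_inj cov meet adjE branch_c.
rewrite (sum_degree_glue splitT f_inj g_inj cov meet adjE).
rewrite (card_edges_glue splitT f_inj g_inj cov meet).
rewrite (one_branch_sum branch_c).
have : c \in branch_vertices S by rewrite branch_c set11.
rewrite inE; move: nuE IH.
move: (nu2 T) (nu2 T') (degree c) (#|edges S|) (#|edges T'|) (\sum_y _)%N.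
move: (nat_of_bool _) => *; lia.
Qed.

(** * Existence of starlike decompositions *)

Section PathCase.
Variable T : sgraph.
Implicit Types U : {set T}.

Definition path_numbering U (h : T -> nat) :=
  [/\ {in U, forall x, h x < #|U|}%N, {in U &, injective h},
      forall i, (i < #|U|)%N -> exists2 x, x \in U & h x = i
    & {in U &, forall x y, adj x y = (h x == (h y).+1) || (h y == (h x).+1)}].

Lemma path_numbering_rev U h :
  path_numbering U h -> path_numbering U (fun x => #|U|.-1 - h x)%N.
Proof.
case=> h_lt h_inj h_surj h_adj.
have h_le x : x \in U -> (h x <= #|U|.-1)%N.
  by move=> /h_lt; case: #|U|.
split=> [x xU|x y xU yU|i lt_i|x y xU yU].
- have := h_lt x xU; case: #|U| => // m _; exact: leq_subr.
- move=> hxy; apply: h_inj => //; move: (h_le x xU) (h_le y yU) hxy => /=.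
  by move: (h x) (h y) (#|U|.-1) => *; lia.
- have U_gt0 : (0 < #|U|)%N by apply: leq_ltn_trans lt_i.
  have [|x xU hx] := h_surj (#|U|.-1 - i)%N.
    by apply: leq_ltn_trans (leq_subr _ _) _; rewrite prednK.
  exists x => //; rewrite hx subKn // -ltnS prednK //.
rewrite h_adj //; move: (h_le x xU) (h_le y yU) => /=.
move: (h x) (h y) (#|U|.-1) => a b m am bm; apply/idP/idP; lia.
Qed.

(** After deletion of a leaf [v], its neighbour [u] has at most one neighbour left and so is an end
    of the remaining path; [v] is appended next to it. *)
Lemma path_numbering_ex U : forest T -> connected_in U -> U != set0 ->
  {in U, forall x, #|nb U x| <= 2}%N -> exists h, path_numbering U h.
Proof.
move=> forestT; move: U; apply: leaf_induction => // [v _|U v u vU nbE IH deg2].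
  exists (fun=> 0%N); split=> [x|x y /set1P-> /set1P->|i|x y /set1P-> /set1P->] //.
  - by rewrite cards1.
  - by rewrite cards1 ltnS leqn0 => /eqP->; exists v; rewrite ?set11.
  - by rewrite adj_irr.
have /[!inE]/andP[uU vu] : u \in nb U v by rewrite nbE set11.
have uUv : u \in U :\ v by rewrite !inE uU andbT eq_sym adj_neq.
have cardU : #|U| = #|U :\ v|.+1 by rewrite (cardsD1 v) vU.
have Uv_gt0 : (0 < #|U :\ v|)%N by apply/card_gt0P; exists u.
have u_leaf : (#|nb (U :\ v) u| <= 1)%N.
  have := deg2 u uU; rewrite (cardsD1 v) inE vU adjC vu add1n ltnS.
  by rewrite nbD1.
have [h0 num0] : exists h, path_numbering (U :\ v) h.
  apply: IH => x; rewrite inE => /andP[_ /deg2]; apply: leq_trans.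
  by rewrite nbD1; apply/subset_leq_card/subsetDl.
(* The numbering is reversed if [u] comes first. An interior position would give [u] both a
   predecessor and a successor in [U :\ v]. *)
have [h [num hu]] : exists h, path_numbering (U :\ v) h /\ h u = #|U :\ v|.-1.
  have [hu0|hu_neq] := eqVneq (h0 u) #|U :\ v|.-1; first by exists h0.
  exists (fun x => #|U :\ v|.-1 - h0 x)%N; split; first exact: path_numbering_rev.
  suff -> : h0 u = 0%N by rewrite subn0.
  case: num0 => h_lt h_inj h_surj h_adj; apply/eqP; apply: contraT => hu_neq0.
  have lt_hu := h_lt u uUv.
  have [|x xU hx] := h_surj (h0 u).-1; first exact: leq_ltn_trans (leq_pred _) lt_hu.
  have [|y yU hy] := h_surj (h0 u).+1.
    by rewrite ltn_neqAle lt_hu andbT -(prednK Uv_gt0) eqSS.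
  have xy : x = y.
    apply: (card_le1_eqP u_leaf); rewrite inE ?xU ?yU h_adj // ?hx ?hy ?eqxx ?orbT //.
    by rewrite prednK ?lt0n ?eqxx.
  by move: hx; rewrite xy hy => /eqP; rewrite gtn_eqF // ltnS leq_pred.
case: num => h_lt h_inj h_surj h_adj.
pose h' x := if x == v then #|U :\ v| else h x.
have h'v : h' v = #|U :\ v| by rewrite /h' eqxx.
have h'h x : x \in U :\ v -> h' x = h x.
  by rewrite /h' !inE => /andP[/negPf->].
have UE x : x \in U -> x = v \/ x \in U :\ v.
  by move=> xU; have [->|x_v] := eqVneq x v; [left | right; rewrite !inE x_v].
have vNadj x : x \in U :\ v -> adj v x = (h' v == (h' x).+1) || (h' x == (h' v).+1).
  move=> xUv; rewrite h'v h'h // [X in _ || X]ltn_eqF ?orbF; last first.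
    by rewrite ltnS ltnW // h_lt.
  have xU : x \in U by move: xUv; rewrite inE => /andP[].
  have -> : adj v x = (x == u) by rewrite -in_set1 -nbE inE xU.
  rewrite -{1}(prednK Uv_gt0) eqSS -hu eq_sym; apply/eqP/eqP => [->//|].
  exact: h_inj.
exists h'; split=> [x /UE[->|xU]|x y /UE[->|xU] /UE[->|yU]|i|x y /UE[->|xU] /UE[->|yU]].
- by rewrite h'v cardU.
- by rewrite h'h // cardU ltnW // ltnS h_lt.
- by [].
- by rewrite h'v h'h // => E; have := h_lt y yU; rewrite -E ltnn.
- by rewrite h'v h'h // => E; have := h_lt x xU; rewrite E ltnn.
- by rewrite !h'h //; apply: h_inj.
- rewrite cardU ltnS leq_eqVlt => /orP[/eqP->|/h_surj[x xU <-]].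
    by exists v.
  by exists x; [move: xU; rewrite inE => /andP[] | apply: h'h].
- by rewrite adj_irr h'v orbb ltn_eqF.
- exact: vNadj.
- by rewrite adjC vNadj // orbC.
by rewrite !h'h // h_adj.
Qed.

Lemma tree_path_graph :
  is_tree T -> branch_vertices T = set0 -> is_path_graph T.
Proof.
move=> treeT no_branch.
have deg2 : {in [set: T], forall x, #|nb [set: T] x| <= 2}%N.
  move=> x _; rewrite -degree_nb leqNgt; apply/negP => x3.
  by have := in_set0 x; rewrite -no_branch inE x3.
have [h [h_lt h_inj _ h_adj]] := path_numbering_ex (tree_forest treeT)
  (tree_connected treeT) (tree_neq0 treeT) deg2.
have h_ltT x : (h x < #|T|)%N by rewrite -cardsT h_lt ?inE.
exists (fun x => Ordinal (h_ltT x)); last by move=> u v; rewrite h_adj ?inE.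
apply: inj_card_bij; last by rewrite card_ord.
by move=> x y [] /h_inj; apply; rewrite inE.
Qed.

End PathCase.

(** * Induced subgraphs as graphs of their own *)

Section Induced.
Variables (T : sgraph) (U : {set T}).

Definition induced_adj : rel {x : T | x \in U} := fun x y => adj (val x) (val y).

Lemma induced_adj_sym : symmetric induced_adj.
Proof. by move=> x y; apply: adj_sym. Qed.

Lemma induced_adj_irr : irreflexive induced_adj.
Proof. by move=> x; apply: adj_irr. Qed.

Definition induced : sgraph := SGraph induced_adj_sym induced_adj_irr.

Lemma card_induced : #|induced| = #|U|.
Proof. by rewrite card_sig. Qed.

Lemma degree_induced (x : induced) : degree x = #|nb U (val x)|.
Proof.
rewrite /degree -(card_imset _ val_inj); apply: eq_card => y; rewrite !inE.
apply/imsetP/andP => [[z /[1!inE] xz ->]|[yU xy]]; first by split; [apply: (valP z)|].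
by exists (Sub y yU); rewrite ?inE.
Qed.

Lemma induced_tree :
  is_tree T -> connected_in U -> U != set0 -> is_tree induced.
Proof.
move=> [_ _ acyc] connU U0; split=> [|x y|s /andP[cyc_s Us]].
- by rewrite card_induced card_gt0.
- pose W := [set val z | z : induced & connect (@adj induced) x z].
  have xW : val x \in W by apply: imset_f; rewrite inE connect0.
  have [WU|W_neqU] := eqVneq W U.
    have : val y \in W by rewrite WU (valP y).
    by case/imsetP=> z /[1!inE] xz /val_inj->.
  have [||//|a [b [/imsetP[z /[1!inE] xz ->]]]] := connU W.
  + by apply/subsetP => _ /imsetP[z _ ->]; apply: (valP z).
  + by apply/set0Pn; exists (val x).
  rewrite inE => /andP[bNW bU] zb; case/negP: bNW; apply/imsetP.
  exists (Sub b bU); rewrite ?inE //; apply: connect_trans xz _.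
  exact: (@connect1 _ (@adj induced) z (Sub b bU)).
rewrite -(size_map val); apply: acyc; rewrite /ucycle map_inj_uniq ?Us ?andbT.
  by rewrite cycle_map.
exact: val_inj.
Qed.

End Induced.

(** * Sides of an edge, and splitting off a starlike piece *)

Section Pendant.
Variable T : sgraph.
Hypothesis treeT : is_tree T.
Implicit Types (X W : {set T}).

(** In a tree, [X] is the component of [c] after deletion of the edge [cw], described by the cut it
    forms. *)
Definition pendant X (c w : T) :=
  [/\ c \in X, w \notin X, adj c w
    & forall x y, x \in X -> y \notin X -> adj x y -> x = c /\ y = w].

Lemma pendantC X c w : pendant X c w -> pendant (~: X) w c.
Proof.
case=> cX wX cw cross; split; rewrite ?inE ?cX 1?adjC // => x y.
rewrite !inE negbK => xX yX xy; have [] := cross y x yX xX => //.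
by rewrite adjC.
Qed.

Lemma pendant_connected X c w : pendant X c w -> connected_in X.
Proof.
case=> _ _ _ cross; rewrite -[X]setCK -setTD.
apply: (connected_in_setD (w := c) (tree_connected treeT)) => x y.
rewrite !inE negbK andbT /= => xX yX xy.
by have [] := cross y x yX xX; rewrite 1?adjC.
Qed.

(** Take the vertices reachable from [u] without the edge [uv]. If [v] were among them, a simple
    path to it would close a cycle of length at least 3 with [uv]. *)
Lemma pendant_edge u v : adj u v -> exists X, pendant X u v.
Proof.
move=> uv; have [_ _ acyc] := treeT.
pose e x y := adj x y && ([set x; y] != [set u; v]).
pose X := [set x | connect e u x]; exists X.
have vX : v \notin X.
  rewrite inE; apply/negP => /connectP[p up vE].
  case/shortenP: up vE => {}p up Up _ vE.
  have cyc : ucycle (@adj T) (u :: p).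
    rewrite /ucycle Up andbT /cycle rcons_path -vE adjC uv andbT.
    by apply: sub_path up => x y /andP[].
  have := acyc _ cyc; case: p up Up vE {cyc} => [|y [|z p]] //=.
    by move=> _ _ vu; move: uv; rewrite vu adj_irr.
  by move=> /andP[/andP[_ /negP uy] _] _ vy; case: uy; rewrite vy.
split=> // [|x y]; first by rewrite inE connect0.
move=> xX yX xy.
have : ~~ e x y.
  apply: contra yX => exy; rewrite inE; apply: connect_trans (connect1 exy).
  by move: xX; rewrite inE.
rewrite /e xy /= negbK => /eqP E.
have : x \in [set u; v] by rewrite -E set21.
have : y \in [set u; v] by rewrite -E set22.
rewrite !inE => /orP[]/eqP yE /orP[]/eqP xE //.
- by move: xy; rewrite xE yE adj_irr.
- by rewrite xE (negPf vX) in xX.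
- by rewrite xE (negPf vX) in xX.
Qed.

(** The edge to cut is the first one on the way from [a] to [b]. It is found without paths: [a] and
    the far sides of all edges at [a] together are closed under adjacency, so they exhaust the tree
    and one far side contains [b]; its complement is the set sought. *)
Lemma pendant_separating a b : a != b ->
  exists X w, pendant X a w /\ b \notin X.
Proof.
move=> ab; pose bad w X := pendant X w a /\ b \in X.
have [[w [X [pX bX]]]|no_sep] := pselect (exists w X, bad w X).
  by exists (~: X), w; split; [apply: pendantC | rewrite inE negbK].
pose Y w := [set x | `[< exists X, pendant X w a /\ x \in X >]].
pose W := a |: \bigcup_(w in [set w | adj a w]) Y w.
have bW : b \notin W.
  rewrite !inE negb_or eq_sym ab; apply/negP => /bigcupP[w _].
  by rewrite inE => /asboolP[X wX]; apply: no_sep; exists w, X.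
have [|||x [y [xW]]] := tree_connected treeT (W := W).
- exact: subsetT.
- by apply/set0Pn; exists a; rewrite setU11.
- by apply: contraNneq bW => ->; rewrite inE.
rewrite inE => /andP[yW _] xy; case/negP: yW.
move: xW => /setU1P[xa|/bigcupP[w /[1!inE] aw /[1!inE] /asboolP[X [pX xX]]]].
  apply/setU1r/bigcupP; exists y; first by rewrite inE -xa.
  have [X pX] : exists X, pendant X y a by apply: pendant_edge; rewrite adjC -xa.
  by rewrite inE; apply/asboolP; exists X; split; last by case: pX.
have [yX|yX] := boolP (y \in X).
  apply/setU1r/bigcupP; exists w; rewrite inE //.
  by apply/asboolP; exists X.
have [_ _ _ cross] := pX; have [_ ->] := cross x y xX yX xy.
exact: setU11.
Qed.

(** Descent on [#|X|]: as long as the side [X] of a branch vertex [c] contains another branch vertex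
    [b], it contains the smaller side of [b] that faces away from [c]. The excluded [c] then serves
    as the branch vertex outside. *)
Lemma pendant_single_branch : (1 < #|branch_vertices T|)%N ->
  exists X c w, pendant X c w /\ X :&: branch_vertices T = [set c].
Proof.
pose good X := exists c w, [/\ pendant X c w, c \in branch_vertices T
  & exists2 b, b \in branch_vertices T & b \notin X].
have descent X : good X -> exists X c w,
    pendant X c w /\ X :&: branch_vertices T = [set c].
  have [n] := ubnP #|X|; elim: n X => // n IHn X lt_X [c [w [pX cB bex]]].
  have [cX wX cw cross] := pX.
  have [XB|] := eqVneq (X :&: branch_vertices T) [set c]; first by exists X, c, w.
  rewrite eqEsubset sub1set inE cX cB /= andbT => /subsetPn[b].
  rewrite !inE => /andP[bX b3] bc.
  have [X' [w' [pX' cX']]] := pendant_separating bc.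
  have [bX' _ _ _] := pX'.
  (* The connected set [X'] meets [X], and could leave it only through [c], which it does not
     contain. *)
  have X'X : X' \subset X.
    apply/setIidPl/eqP; apply: contraT => neq.
    have [||//|x [y [/setIP[xX' xX] /[!inE] /andP[yNX yX'] xy]]] :=
        pendant_connected pX' (W := X' :&: X).
    - exact: subsetIl.
    - by apply/set0Pn; exists b; rewrite inE bX' bX.
    rewrite yX' /= in yNX; have [xc _] := cross x y xX yNX xy.
    by rewrite -xc xX' in cX'.
  apply: (IHn X'); last first.
    by exists b, w'; split; rewrite ?inE //; exists c.
  apply: leq_trans (proper_card _) (lt_X : (#|X| <= n)%N).
  by apply/properP; split=> //; exists c.
move=> /card_gt1P[a [b [aB bB ab]]].
have [X [w [pX bX]]] := pendant_separating ab.
by apply: (descent X); exists a, w; split=> //; exists b.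
Qed.

Section Piece.
Variables (X : {set T}) (c w : T).
Hypotheses (pX : pendant X c w) (XB : X :&: branch_vertices T = [set c]).

Let w_piece : w \in w |: X. Proof. exact: setU11. Qed.
Let w_rest : w \in ~: X. Proof. by case: pX => _ ?; rewrite inE. Qed.
Let c_piece : c \in w |: X. Proof. by case: pX => ? _ _ _; apply: setU1r. Qed.

(** The vertex [w] belongs to both pieces: in [S] it is a leaf attached to [c], in [T'] it is the
    vertex to which that leaf is glued. *)
Let S : sgraph := induced (w |: X).
Let T' : sgraph := induced (~: X).
Let vs : S := Sub w w_piece.
Let vt : T' := Sub w w_rest.

Lemma nb_piece x : x \in X -> nb (w |: X) x = nb [set: T] x.
Proof.
move=> xX; apply/setP => y; rewrite !inE; case xy: (adj x y); rewrite ?andbF // !andbT.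
have [yX|yX] := boolP (y \in X); rewrite ?orbT // orbF.
by case: pX => _ _ _ cross; have [_ ->] := cross x y xX yX xy; rewrite eqxx.
Qed.

Lemma nb_piece_end : nb (w |: X) w = [set c].
Proof.
case: pX => cX wX cw cross; apply/setP => y; rewrite !inE.
apply/andP/eqP => [[/orP[/eqP->|yX] wy]|->].
- by rewrite adj_irr in wy.
- by have [] := cross y w yX wX; rewrite 1?adjC.
by rewrite cX orbT adjC.
Qed.

Lemma piece_connected : connected_in (w |: X).
Proof.
case: pX => cX wX cw cross.
have -> : w |: X = [set: T] :\: (~: X :\ w).
  by apply/setP => x; rewrite !inE negb_and !negbK andbT.
apply: (connected_in_setD (w := w) (tree_connected treeT)) => x y.
rewrite !inE negb_and !negbK andbT => /and3P[_ x_w xX] /orP[/eqP//|yX] xy.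
have [|_ xw] := cross y x yX xX; first by rewrite adjC.
by rewrite xw eqxx in x_w.
Qed.

(** Vertices of [X] keep all their neighbours in [S], so only [c] branches there, and [w] has degree
    1. *)
Lemma branch_piece : branch_vertices S = [set (Sub c c_piece : S)].
Proof.
apply/setP => x; rewrite !inE degree_induced -val_eqE /=.
have := valP x; rewrite inE => /orP[/set1P xw|xX].
  rewrite xw nb_piece_end cards1; apply/esym/negbTE.
  by case: pX => _ _ /adj_neq; rewrite eq_sym.
by rewrite nb_piece // -degree_nb -in_set1 -XB !inE xX.
Qed.

Lemma piece_splitting : (1 < #|branch_vertices T|)%N -> starlike_splitting T vs vt.
Proof.
move=> T_branch; have [cX wX cw cross] := pX; split=> //.
- split; last by rewrite branch_piece cards1.
  by apply: induced_tree piece_connected _ => //; apply/set0Pn; exists w.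
- apply: induced_tree => //; first exact: pendant_connected (pendantC pX).
  by apply/set0Pn; exists w.
- by rewrite degree_induced nb_piece_end cards1.
- exists (Sub c c_piece : S); first by rewrite branch_piece set11.
  by rewrite /adj /= /induced_adj /= adjC.
exists val, val; split; try exact: val_inj.
- move=> z; have [zX|zX] := boolP (z \in X).
    by left; exists (Sub z (setU1r w zX)).
  have zC : z \in ~: X by rewrite inE.
  by right; exists (Sub z zC).
- move=> x y; split=> [xy|[-> ->]//]; have := valP x; have := valP y.
  rewrite -xy inE => xX; rewrite !inE (negPf xX) orbF => /eqP xw.
  by split; apply: val_inj; rewrite //= -xy.
have inS x y : x \in X -> adj x y ->
    exists a b : S, [/\ x = val a, y = val b & adj a b].
  move=> xX xy; have xS := setU1r w xX.
  have yS : y \in w |: X.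
    by have : y \in nb (w |: X) x; [rewrite nb_piece // !inE | rewrite inE => /andP[]].
  by exists (Sub x xS), (Sub y yS).
move=> x y; split=> [xy|[[a [b [-> ->]]]|[a [b [-> ->]]]]//].
have [xX|xX] := boolP (x \in X); first by left; apply: inS.
have [yX|yX] := boolP (y \in X).
  left; have [|b [a [-> -> ba]]] := inS y x yX; first by rewrite adjC.
  by exists a, b; rewrite adjC.
have xC : x \in ~: X by rewrite inE.
have yC : y \in ~: X by rewrite inE.
by right; exists (Sub x xC), (Sub y yC).
Qed.

End Piece.
End Pendant.

Lemma starlike_decomposition_ex (T : sgraph) :
  is_tree T -> exists k, starlike_decomposition T k.
Proof.
have [n] := ubnP #|T|; elim: n T => // n IHn T lt_T treeT.
have [T_branch|le1] := ltnP 1 #|branch_vertices T|; last first.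
  exists 0%N; apply: Decomp_stop.
  have [no_branch|/set0Pn[c cB]] := eqVneq (branch_vertices T) set0.
    by right; split=> //; apply: tree_path_graph.
  left; split=> //; apply/eqP; rewrite eqn_leq le1.
  by apply/card_gt0P; exists c.
have [X [c [w [pX XB]]]] := pendant_single_branch treeT T_branch.
have splitT := piece_splitting treeT pX XB T_branch.
have [|k dec] := IHn _ _ (split_rest splitT); last by eexists; apply: Decomp_split splitT dec.
have [cX _ _ _] := pX.
rewrite card_induced; apply: leq_trans (lt_T : (#|T| <= n)%N).
rewrite -cardsT; apply/proper_card/properP; split; first exact: subsetT.
by exists c; rewrite ?inE // cX.
Qed.

Theorem theorem5p5 (T : sgraph) (treeT : is_tree T) (cardT : (2 <= #|T|)%N) :
  let leaf_bound : int :=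
    (num_leaves T)%:Z - 2 - (splitting_irregularity T)%:Z in
  let edge_bound : int := #|edges T|%:Z - (nu2 T)%:Z in
  [/\ forall (d : 'rV[int]_#|T|) (r : 'cV[int]_#|T|),
        arithmetical_structure d r ->
        (num_invariant_factors (critical_group d))%:Z <= leaf_bound,
      leaf_bound = edge_bound
    & forall t : int, 0 <= t -> t <= leaf_bound ->
        exists (d : 'rV[int]_#|T|) (r : 'cV[int]_#|T|),
          arithmetical_structure d r /\
          (num_invariant_factors (critical_group d))%:Z = t].
Proof.
move=> leaf_bound edge_bound.
have boundE : leaf_bound = edge_bound.
  (* Existence of a decomposition ensures that the chosen value is attained and is not the default
     0. *)
  have dec : starlike_decomposition T (splitting_irregularity T).
    have [k] := starlike_decomposition_ex treeT.
    exact: (@classical_sets.xgetI _ 0%N (fun k => starlike_decomposition T k)).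
  have count := decomposition_count dec cardT.
  have leaves := num_leavesE treeT cardT.
  rewrite /leaf_bound /edge_bound leaves; move: count.
  move: (splitting_irregularity T) (nu2 T) #|edges T| (\sum_(v : T) _)%N.
  by move=> *; lia.
split=> // [d r str|t t_ge0].
  rewrite boundE /edge_bound; move: (num_invariant_factors_le treeT str).
  move: (num_invariant_factors _) (nu2 T) #|edges T| => *; lia.
rewrite boundE /edge_bound => t_le.
have [|d [r [str tE]]] := num_invariant_factors_attained treeT (t := `|t|%N).
  by move: t_ge0 t_le; move: (nu2 T) #|edges T| => *; lia.
by exists d, r; rewrite tE gez0_abs.
Qed.
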